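(* Suppose $\mathcal Q$ is vertically unbounded, $s_\infty=1$ and $v(p)\in H$. Then $J=\emptyset$, i.e. $B=\{0,1,\dots,D\}$.
   Context: Let $(K,v)$ be a valued field and $p$ the characteristic exponent of its residue field ($p=1$ if the residue characteristic is $0$, otherwise $p$ is the residue characteristic); $v(p)$ denotes the value of $p\cdot1\in K$ (so $v(p)=\infty$ if $\mathrm{char}K=p>0$). Let $\Gamma$ be the divisible hull of $vK$, embedded in a divisible ordered abelian group $\Lambda$. Let $\nu\colon K[x]\to\Lambda\cup\{\infty\}$ be a valuation extending $v$ which is well-specified, i.e. it is not the case that simultaneously $\nu^{-1}(\infty)=0$, the value group of $\nu$ modulo $\Gamma$ is torsion, and the residue field of $\nu$ is algebraic over that of $v$. For $s\ge0$ let $\partial_s$ be the $s$-th Hasse–Schmidt derivative, defined by $f(x+y)=\sum_{s\ge0}(\partial_sf)y^s$. For nonconstant $f$ with $\nu(f)<\infty$ the level is $\epsilon_\nu(f)=\max\{(\nu(f)-\nu(\partial_sf))/s: s\ge1\}$ and $I(f)$ is the set of $s\ge1$ attaining the maximum; $\epsilon_\nu(a)=-\infty$ for $a\in K$. A monic $Q\in K[x]$ is a key polynomial for $\nu$ if $\epsilon_\nu(f)<\epsilon_\nu(Q)$ whenever $\deg f<\deg Q$. For monic $Q$, each $f$ has a unique $Q$-expansion $f=\sum_{i\ge0}f_{Q,i}Q^i$ with $\deg f_{Q,i}<\deg Q$; set $\nu_Q(f)=\min_i\nu(f_{Q,i}Q^i)$. Fix $m\ge1$ such that the set $\Psi_m$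 of key polynomials of degree $m$ for $\nu$ is nonempty and has no element of maximal $\nu$-value. Let $\mathcal Q\subseteq\Psi_m$ be well-ordered by $Q<R\iff\nu(Q)<\nu(R)$ and cofinal in $\Psi_m$ for $\nu$-values; write $\gamma_Q=\nu(Q)$. As in the paper, all values $\nu_Q(f)$ ($f\ne0$) lie in $\Gamma$. ''For all $Q$ large enough'' means for all $Q$ in a final segment of $\mathcal Q$. For all $Q$ large enough, $I(Q)=\{s_\infty\}$ for a fixed integer $s_\infty\ge1$. $f$ is $\mathcal Q$-stable if $\nu_Q(f)=\nu(f)$ for all $Q$ large enough, $\mathcal Q$-unstable otherwise. Assume unstable polynomials exist; limit key polynomials are the monic $\mathcal Q$-unstable polynomials of minimal degree, forming $\mathrm{KP}_\infty(\mathcal Q)$. Fix $F\in\mathrm{KP}_\infty(\mathcal Q)$, $D=\lfloor\deg F/m\rfloor$, $F=\sum_{\ell=0}^DF_{Q,\ell}Q^\ell$, $\beta_{Q,\ell}=\nu(F_{Q,\ell})\in\Gamma\cup\{\infty\}$. Let $\delta^L$ be the smallest initial segment of $\Gamma$ containing $\{\nu_Q(F):Q\in\mathcal Q\}$; write $x>\delta^L$ if $x\in(\Gamma\setminus\delta^L)\cup\{\infty\}$. Let $J$ be the set of $\ell\in\{0,\dots,D\}$ with $\beta_{Q,\ell}+\ell\gamma_Q>\delta^L$ for all $Q$ large enough, and $B=\{0,\dots,D\}\setminus J$. A cut $\eta=(\eta^L,\eta^R)$ of $\Gamma$ is vertically bounded if for every $x\in\eta^L$ and rational $q>1$ there is $y\in\eta^L$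 with $q(y-x)>z-x$ for all $z\in\eta^L$; its invariance group is $\{h\in\Gamma:h+\eta^L=\eta^L\}$. Let $\gamma_{\mathcal Q}$ be the cut whose lower set is the smallest initial segment of $\Gamma$ containing $\{\gamma_Q\}$; $\mathcal Q$ is vertically unbounded if $\gamma_{\mathcal Q}$ is not vertically bounded; $H$ is the invariance group of $\gamma_{\mathcal Q}$. *)

(* Defs.v *)
From HB Require Import structures.
From mathcomp Require Import all_boot all_order all_algebra.
Set Implicit Arguments. Unset Strict Implicit. Unset Printing Implicit Defensive.
Import GRing.Theory.
Local Open Scope ring_scope.

(* The divisible ordered abelian group Lambda is modelled as a rat-vector space
   L (a divisible torsion-free abelian group carries a unique Q-vector space
   structure) together with a total order [le] compatible with addition.
   [option L] with [None] is used both for Lambda u {oo} (None = +oo) and,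
   for levels, Lambda u {-oo} (None = -oo). *)

Section ValuedDefs.
Variable L : lmodType rat.
Variable le : rel L.

Definition ltL (a b : L) : bool := le a b && ~~ le b a.

Definition ordered_group : Prop :=
  [/\ reflexive le, antisymmetric le, transitive le, total le
    & forall a b c, le a b -> le (a + c) (b + c)].

Definition ole (x y : option L) : bool :=
  match x, y with
  | _, None => true
  | None, Some _ => false
  | Some a, Some b => le a b
  end.
Definition olt (x y : option L) : bool := ole x y && ~~ ole y x.
Definition oadd (x y : option L) : option L :=
  match x, y with Some a, Some b => Some (a + b) | _, _ => None end.
Definition omuln (x : option L) (n : nat) : option L :=
  match x with Some a => Some (a *+ n) | None => None end.
Definition omin (x y : option L) : option L := if ole x y then x else y.

Definition mle (x y : option L) : bool :=
  match x, y with
  | None, _ => true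
  | Some _, None => false
  | Some a, Some b => le a b
  end.
Definition mlt (x y : option L) : bool := mle x y && ~~ mle y x.
Definition mmax (x y : option L) : option L := if mle x y then y else x.

Variable K : fieldType.
Variable v : K -> option L.

Definition is_valuation : Prop :=
  [/\ forall a, v a = None <-> a = 0,
      forall a b, v (a * b) = oadd (v a) (v b)
    & forall a b, ole (omin (v a) (v b)) (v (a + b))].

(* Gamma = divisible hull of vK inside Lambda *)
Definition in_Gamma (g : L) : Prop := exists n : nat, exists a : K, v a = Some (g *+ n.+1).

Definition res_char_exp (p : nat) : Prop :=
  (prime p /\ olt (Some 0) (v p%:R)) \/
  (p = 1%N /\ forall q, prime q -> v q%:R = Some 0).

Variable nu : {poly K} -> option L.

(* nu is a valuation on K[x] (possibly with nonzero support) extending v *)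
Definition extends_valuation : Prop :=
  [/\ forall f g, nu (f * g) = oadd (nu f) (nu g),
      forall f g, ole (omin (nu f) (nu g)) (nu (f + g))
    & forall c, nu c%:P = v c].

Definition support_trivial : Prop := forall f, nu f = None -> f = 0.

Definition value_group_torsion_mod_Gamma : Prop :=
  forall f g a b, nu f = Some a -> nu g = Some b ->
    exists n : nat, in_Gamma ((a - b) *+ n.+1).

(* every residue class of nu (class of f/g with nu f >= nu g < oo) is a root
   of a nonzero polynomial over the residue field of v *)
Definition residue_field_algebraic : Prop :=
  forall f g b, nu g = Some b -> ole (Some b) (nu f) ->
    exists (n : nat) (a : nat -> K),
      [/\ forall i, (i <= n)%N -> ole (Some 0) (v (a i)),
          exists2 i, (i <= n)%N & v (a i) = Some 0
        & olt (Some (b *+ n))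
              (nu (\sum_(i < n.+1) (a i)%:P * f ^+ i * g ^+ (n - i)))].

Definition well_specified : Prop :=
  ~ [/\ support_trivial, value_group_torsion_mod_Gamma & residue_field_algebraic].

Definition level_term (f : {poly K}) (s : nat) : option L :=
  match nu f, nu (nderivn s f) with
  | Some a, Some b => Some ((s%:R : rat)^-1 *: (a - b))
  | _, _ => None
  end.

(* level eps_nu(f); None = -oo (constants).  For s >= size f the term is -oo
   since the derivative vanishes, so the max over 1 <= s < size f suffices. *)
Definition level (f : {poly K}) : option L :=
  if (size f <= 1)%N then None
  else \big[mmax/None]_(1 <= s < size f) level_term f s.

Definition Iset (f : {poly K}) (s : nat) : Prop :=
  (1 <= s)%N /\ level_term f s = level f.

Definition key_poly (Q : {poly K}) : Prop :=
  [/\ Q \is monic, nu Q <> None &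
      forall f : {poly K}, (size f < size Q)%N -> (nu f <> None \/ (size f <= 1)%N) ->
        mlt (level f) (level Q)].

Definition Psi (m : nat) (Q : {poly K}) : Prop := key_poly Q /\ size Q = m.+1.

Definition coefQ (Q f : {poly K}) (i : nat) : {poly K} := (f %/ Q ^+ i) %% Q.
Definition nuQ (Q f : {poly K}) : option L :=
  \big[omin/None]_(i < size f) nu (coefQ Q f i * Q ^+ i).

Variable Qs : {poly K} -> Prop.

Definition eventually (P : {poly K} -> Prop) : Prop :=
  exists2 Q0, Qs Q0 & forall Q, Qs Q -> ole (nu Q0) (nu Q) -> P Q.

Definition Qstable (f : {poly K}) : Prop := eventually (fun Q => nuQ Q f = nu f).

Definition limit_key_poly (F : {poly K}) : Prop :=
  [/\ F \is monic, ~ Qstable F &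
      forall g : {poly K}, g \is monic -> ~ Qstable g -> (size F <= size g)%N].

Definition gammaL (x : L) : Prop :=
  in_Gamma x /\ exists Q g, [/\ Qs Q, nu Q = Some g & le x g].

Variable F : {poly K}.

Definition deltaL (x : L) : Prop :=
  in_Gamma x /\ exists Q y, [/\ Qs Q, nuQ Q F = Some y & le x y].

Definition above_deltaL (x : option L) : Prop :=
  match x with None => True | Some a => in_Gamma a /\ ~ deltaL a end.

Definition betaQ (Q : {poly K}) (l : nat) : option L := nu (coefQ Q F l).

Definition Jset (m l : nat) : Prop :=
  (l <= (size F).-1 %/ m)%N /\
  eventually (fun Q => above_deltaL (oadd (betaQ Q l) (omuln (nu Q) l))).

End ValuedDefs.

Section Cuts.
Variable L : lmodType rat.
Variable le : rel L.
Variable low : L -> Prop. (* lower set of a cut *)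

Definition vertically_bounded : Prop :=
  forall x, low x -> forall q : rat, 1 < q ->
    exists y, low y /\ forall z, low z -> ltL le (z - x) (q *: (y - x)).

Variable Gamma : L -> Prop.
Definition invariance_group (h : L) : Prop :=
  Gamma h /\ forall y, low y <-> exists x, low x /\ y = h + x.
End Cuts.

(* Main.v *)
Require Import Defs.
From HB Require Import structures.
From mathcomp Require Import all_boot all_order all_algebra.
From mathcomp Require Import ring lra.
From mathcomp Require Import zify.
From Stdlib Require Import Classical.
Set Implicit Arguments. Unset Strict Implicit. Unset Printing Implicit Defensive.
Import GRing.Theory.
Local Open Scope ring_scope.

(** Write [F(x + y) = sum_s (d_s F) y^s] and let [N_Q] be the Gauss-type valuation
giving [y] the weight [eps(Q) = nu(Q) - nu(Q')]; [nu(Q')] does not depend on [Q].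
Polynomials of degree less than [m] have leading part constant in [y], whereas
[Q] (since [s_infty = 1]) has leading part [Q + Q' y], so that for [Q >= Q0] in the
family [N_Q0 (sum_j f_j Q^j) = min_j (nu f_j + j nu(Q0))]; for [Q = Q0] this is
[nu_Q0].  Vertical unboundedness makes the differences [nu(Q) - nu(Q0)] cofinal in
[H], and [H] contains every [v(n)].

If [l] lies in [J], let [i] be minimal such that the coefficients [F_{R,l+i}] do
not become arbitrarily large modulo [H] as [R] grows; it exists, because if the
top coefficient did so, removing the top term of [F] would leave an unstable
polynomial of smaller degree.  Substituting [R = Q + a] in the [R]-expansion of [F]
gives [F_{Q,l} = binom(l+i, i) F_{R,l+i} a^i + ...], where the omitted terms are
larger once [nu(Q)] is large in its coset of [H].  Hence [nu(F_{Q,l}) + l nu(Q)]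
stays below [delta], a contradiction. *)

(* The square-zero extension [rat * L] is a commutative ring containing [L], so
   that [ring] proves identities in [L]. *)
Section SquareZero.
Variable L : lmodType rat.
Definition sqz : Type := (rat * L)%type.
HB.instance Definition _ := GRing.Zmodule.on sqz.
Definition sqz_mul (x y : sqz) : sqz := (x.1 * y.1, x.1 *: y.2 + y.1 *: x.2).
Fact sqz_mulA : associative sqz_mul.
Proof.
move=> x y z; rewrite /sqz_mul /=; congr (_, _); first by rewrite mulrA.
by rewrite !scalerDr !scalerA addrA [z.1 * x.1]mulrC [z.1 * y.1]mulrC.
Qed.
Fact sqz_mulC : commutative sqz_mul.
Proof. by move=> x y; rewrite /sqz_mul mulrC addrC. Qed.
Fact sqz_mul1 : left_id ((1, 0) : sqz) sqz_mul.
Proof. by case=> a x; rewrite /sqz_mul /= mul1r scale1r scaler0 addr0. Qed.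
Fact sqz_mulD : left_distributive sqz_mul +%R.
Proof.
move=> x y z; rewrite /sqz_mul /=; congr (_, _); first by rewrite mulrDl.
by rewrite /= scalerDl scalerDr addrACA.
Qed.
Fact sqz_oner_neq0 : ((1, 0) : sqz) != 0.
Proof. by []. Qed.
HB.instance Definition _ := GRing.Zmodule_isComNzRing.Build sqz
  sqz_mulA sqz_mulC sqz_mul1 sqz_mulD sqz_oner_neq0.
Definition sqz_in (x : L) : sqz := (0, x).
Fact sqz_in_additive : zmod_morphism sqz_in.
Proof. by move=> x y; congr (_, _); rewrite subr0. Qed.
HB.instance Definition _ := GRing.isZmodMorphism.Build L sqz sqz_in sqz_in_additive.
Lemma sqz_in_inj : injective sqz_in.
Proof. by move=> x y []. Qed.
End SquareZero.

Ltac zmod := apply: sqz_in_inj; ring.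

(** * Ordered divisible groups *)

Section Values.
Variables (L : lmodType rat) (le : rel L).
Hypothesis leOG : ordered_group le.

Lemma le_refl a : le a a.
Proof. by case: leOG => r *; apply: r. Qed.

Lemma le_tr b a c : le a b -> le b c -> le a c.
Proof. by case: leOG => _ _ t _ _; apply: t. Qed.

Lemma le_eq a b : le a b -> le b a -> a = b.
Proof. by case: leOG => _ t _ _ _ h1 h2; apply: t; rewrite h1 h2. Qed.

Lemma nle_le a b : ~~ le a b -> le b a.
Proof. by case: leOG => _ _ _ t _ h; case/orP: (t a b) => //; rewrite (negPf h). Qed.

Lemma leD2 a b c d : le a b -> le c d -> le (a + c) (b + d).
Proof.
case: leOG => _ _ _ _ t h1 h2; apply: (@le_tr (b + c)); first exact: t.
by rewrite ![b + _]addrC; apply: t.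
Qed.

(** Turns an inequality into a certificate: a non-negative [c], usually a sum of known differences,
    and an identity left to [zmod]. *)
Lemma le_cert c a b : le 0 c -> b = a + c -> le a b.
Proof. by move=> h ->; rewrite -{1}[a]addr0; apply: leD2 => //; apply: le_refl. Qed.

Lemma sub_le a b : le a b -> le 0 (b - a).
Proof. by move=> h; rewrite -(subrr a); apply: leD2 => //; apply: le_refl. Qed.

Lemma leMn a b n : le a b -> le (a *+ n) (b *+ n).
Proof.
by move=> h; elim: n => [|n IH]; rewrite ?mulr0n ?le_refl // !mulrS leD2.
Qed.

Lemma nnMn a n : le 0 a -> le 0 (a *+ n).
Proof. by move=> h; rewrite -(mul0rn L n) leMn. Qed.

Lemma nnD a b : le 0 a -> le 0 b -> le 0 (a + b).
Proof. by move=> h1 h2; rewrite -[0]addr0 leD2. Qed.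

Lemma leMn_cancel a b n : le (a *+ n.+1) (b *+ n.+1) -> le a b.
Proof.
move=> h; have [//|hba] : le a b \/ le b a.
  by case: (boolP (le a b)) => [|/nle_le]; [left | right].
(* In the remaining case b <= a, so b - a is a sum of two non-negative terms. *)
apply: (le_cert (c := (b *+ n.+1 - a *+ n.+1) + (a - b) *+ n)); last by zmod.
by apply: nnD; [apply: sub_le | apply/nnMn/sub_le].
Qed.

Lemma eqMn_cancel (a b : L) n : a *+ n.+1 = b *+ n.+1 -> a = b.
Proof. by move=> h; apply: le_eq; apply: (@leMn_cancel _ _ n); rewrite h le_refl. Qed.

Lemma nle_trl b a c : ~~ le a b -> le c b -> ~~ le a c.
Proof. by move=> h1 h2; apply: contra h1 => h; apply: le_tr h2. Qed.

Lemma nle_trr b a c : ~~ le b a -> le b c -> ~~ le c a.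
Proof. by move=> h1 h2; apply: contra h1; apply: le_tr. Qed.

(** Taking the last minimal index makes all later values strictly larger, which helps to isolate one
    term of a sum. *)
Lemma mem_last_min (val : nat -> option L) n j :
  (j < n)%N -> val j <> None ->
  exists i c, [/\ (i < n)%N, val i = Some c,
    forall k, (k < n)%N -> ole le (Some c) (val k)
  & forall k, (i < k < n)%N -> olt le (Some c) (val k)].
Proof.
elim: n j => // n IH j hj hv.
have [[k hk hvk]|hno] := classic (exists2 k, (k < n)%N & val k <> None).
  have [i [c [hi hic hmin hlast]]] := IH k hk hvk.
  case hn: (val n) => [b|]; last first.
    exists i, c; split=> // [|l|l]; first exact: ltnW.
      by rewrite ltnS leq_eqVlt => /orP[/eqP->|/hmin]; rewrite ?hn.
    move=> /andP[h1]; rewrite ltnS leq_eqVlt => /orP[/eqP->|h2]; rewrite ?hn //.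
    by apply: hlast; rewrite h1.
  case: (boolP (le b c)) => hbc.
    exists n, b; split=> // [l|l /andP[h1 h2]]; last by lia.
    rewrite ltnS leq_eqVlt => /orP[/eqP->|/hmin]; rewrite ?hn /= ?le_refl //.
    by case: (val l) => //= a; apply: le_tr.
  exists i, c; split=> // [|l|l]; first exact: ltnW.
    by rewrite ltnS leq_eqVlt => /orP[/eqP->|/hmin]; rewrite ?hn //= nle_le.
  move=> /andP[h1]; rewrite ltnS leq_eqVlt => /orP[/eqP->|h2].
    by rewrite hn /olt /= nle_le.
  by apply: hlast; rewrite h1.
have hjn : j = n.
  by apply/eqP; rewrite eqn_leq -ltnS hj leqNgt; apply/negP => h; apply: hno; exists j.
move: hv; rewrite {}hjn; case hn: (val n) => [b|] // _.
have hN k : (k < n)%N -> val k = None.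
  by move=> hk; case hvk: (val k) => // ; case: hno; exists k => //; rewrite hvk.
exists n, b; split=> // [l|l /andP[h1 h2]]; last by lia.
by rewrite ltnS leq_eqVlt => /orP[/eqP->|/hN->]; rewrite ?hn //= le_refl.
Qed.

(** * Calculus of valuations *)

Variables (K : fieldType) (v : K -> option L) (nu : {poly K} -> option L).
Hypothesis valV : is_valuation le v.
Hypothesis extV : extends_valuation le v nu.
Implicit Types f Q R : {poly K}.

(** An infinite value satisfies every finite lower bound, so sums and products can be estimated
    without splitting off that case. *)
Definition ge (f : {poly K}) (a : L) : bool := ole le (Some a) (nu f).
Definition gt (f : {poly K}) (a : L) : bool := olt le (Some a) (nu f).

Lemma geE f a b : nu f = Some b -> ge f a = le a b.
Proof. by rewrite /ge => ->. Qed.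

Lemma gtE f a b : nu f = Some b -> gt f a = ~~ le b a.
Proof.
rewrite /gt /olt => -> /=; case: (boolP (le b a)); rewrite ?andbF // andbT.
exact: nle_le.
Qed.

Lemma ge_None f a : nu f = None -> ge f a.
Proof. by rewrite /ge => ->. Qed.

Lemma gt_None f a : nu f = None -> gt f a.
Proof. by rewrite /gt /olt => ->. Qed.

Lemma nuM f g : nu (f * g) = oadd (nu f) (nu g).
Proof. by case: extV => h _ _; apply: h. Qed.

Lemma nuC c : nu c%:P = v c.
Proof. by case: extV => _ _ h; apply: h. Qed.

Lemma nu0 : nu 0 = None.
Proof. by rewrite -[0]/(0%:P) nuC; case: valV => h _ _; apply/h. Qed.

Lemma v_fin c : c != 0 -> exists a, v c = Some a.
Proof.
case hc: (v c) => [a|] nz; first by exists a.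
by case: valV => h _ _; case/eqP: nz; apply/h.
Qed.

Lemma vM a b : v (a * b) = oadd (v a) (v b).
Proof. by case: valV => _ h _; apply: h. Qed.

Lemma v1 : v 1 = Some 0.
Proof.
have [a ha] := v_fin (oner_neq0 K); have := vM 1 1.
rewrite mulr1 ha /= => -[] h; congr Some.
by apply: (addrI a); rewrite addr0.
Qed.

Lemma vX c a n : v c = Some a -> v (c ^+ n) = Some (a *+ n).
Proof.
by move=> h; elim: n => [|n IH]; rewrite ?expr0 ?v1 ?mulr0n // exprS vM IH h mulrS.
Qed.

Lemma vV c a : v c = Some a -> v c^-1 = Some (- a).
Proof.
move=> h; have nz : c != 0.
  by apply/eqP => c0; case: valV => /(_ c) [_ /(_ c0)]; rewrite h.
have [b hb] := v_fin (invr_neq0 nz).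
have := vM c c^-1; rewrite mulfV // v1 h hb /= => -[] e; congr Some.
by apply: (addrI a); rewrite -e subrr.
Qed.

(** The square of -1 has value 0, and the ordered group is torsion-free. *)
Lemma vN1 : v (-1) = Some 0.
Proof.
have nz : (-1 : K) != 0 by rewrite oppr_eq0 oner_neq0.
have [a ha] := v_fin nz; have := vM (-1) (-1).
rewrite mulrNN mulr1 v1 ha /= => -[] h; congr Some.
by apply: (@eqMn_cancel _ _ 1); rewrite mul0rn mulr2n.
Qed.

Lemma nu1 : nu 1 = Some 0.
Proof. by rewrite -[1]/(1%:P) nuC v1. Qed.

Lemma nuN f : nu (- f) = nu f.
Proof.
rewrite -mulN1r nuM -[-1]/(- (1%:P)) -polyCN nuC vN1.
by case: (nu f) => //= a; rewrite add0r.
Qed.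

Lemma nuX f a n : nu f = Some a -> nu (f ^+ n) = Some (a *+ n).
Proof.
by move=> h; elim: n => [|n IH]; rewrite ?expr0 ?nu1 ?mulr0n // exprS nuM IH h mulrS.
Qed.

Lemma ge_le b a f : le a b -> ge f b -> ge f a.
Proof. by rewrite /ge; case: (nu f) => //= c; apply: le_tr. Qed.

Lemma gt_le b a f : le a b -> gt f b -> gt f a.
Proof.
move=> h; case hf: (nu f) => [c|]; last by rewrite !gt_None.
by rewrite !(gtE _ hf) => h1; apply: nle_trl h1 h.
Qed.

Lemma gtW f a : gt f a -> ge f a.
Proof. by case/andP. Qed.

Lemma ge_gt b a f : ~~ le b a -> ge f b -> gt f a.
Proof.
case hf: (nu f) => [c|]; last by rewrite gt_None.
by rewrite (geE _ hf) (gtE _ hf); apply: nle_trr.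
Qed.

Lemma ge0 a : ge 0 a. Proof. exact: ge_None nu0. Qed.
Lemma gt0 a : gt 0 a. Proof. exact: gt_None nu0. Qed.

Lemma ge_add f g a : ge f a -> ge g a -> ge (f + g) a.
Proof.
case: extV => _ /(_ f g) + _; rewrite /ge /omin.
case: (nu f) => [b|]; case: (nu g) => [c|] //=; case: (nu (f + g)) => [d|] //=.
- by case: ifP => _ h h1 h2; [apply: le_tr h1 h | apply: le_tr h2 h].
- by move=> h h1 _; apply: le_tr h1 h.
- by move=> h _ h1; apply: le_tr h1 h.
Qed.

Lemma ge_ngt f a : ge f a -> ~~ gt f a -> nu f = Some a.
Proof.
case hf: (nu f) => [b|]; last by rewrite gt_None.
by rewrite (geE _ hf) (gtE _ hf) negbK => h1 h2; rewrite (le_eq h1 h2).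
Qed.

Lemma gt_add f g a : gt f a -> gt g a -> gt (f + g) a.
Proof.
case: extV => _ /(_ f g) + _; rewrite /gt /olt /omin.
case: (nu f) => [b|]; case: (nu g) => [c|] //=; case: (nu (f + g)) => [d|] //=.
- case: ifP => _ h /andP[h1 h1'] /andP[h2 h2'].
    by rewrite (le_tr h1 h) (nle_trr h1' h).
  by rewrite (le_tr h2 h) (nle_trr h2' h).
- by move=> h /andP[h1 h1'] _; rewrite (le_tr h1 h) (nle_trr h1' h).
- by move=> h _ /andP[h1 h1']; rewrite (le_tr h1 h) (nle_trr h1' h).
Qed.

Lemma ge_opp f a : ge (- f) a = ge f a. Proof. by rewrite /ge nuN. Qed.
Lemma gt_opp f a : gt (- f) a = gt f a. Proof. by rewrite /gt nuN. Qed.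

Lemma ge_sub f g a : ge f a -> ge g a -> ge (f - g) a.
Proof. by move=> h1 h2; apply: ge_add; rewrite ?ge_opp. Qed.

Lemma gt_sub f g a : gt f a -> gt g a -> gt (f - g) a.
Proof. by move=> h1 h2; apply: gt_add; rewrite ?gt_opp. Qed.

Lemma ge_sum (I : Type) (r : seq I) (P : pred I) (E : I -> {poly K}) a :
  (forall i, P i -> ge (E i) a) -> ge (\sum_(i <- r | P i) E i) a.
Proof. by move=> h; apply: (big_ind (ge^~ a)) => // [|f g]; [apply: ge0 | apply: ge_add]. Qed.

Lemma gt_sum (I : Type) (r : seq I) (P : pred I) (E : I -> {poly K}) a :
  (forall i, P i -> gt (E i) a) -> gt (\sum_(i <- r | P i) E i) a.
Proof. by move=> h; apply: (big_ind (gt^~ a)) => // [|f g]; [apply: gt0 | apply: gt_add]. Qed.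

Lemma ge_Mn f a n : ge f a -> ge (f *+ n) a.
Proof. by move=> h; elim: n => [|n IH]; rewrite ?mulr0n ?ge0 // mulrS ge_add. Qed.

Lemma ge_mul f g a b : ge f a -> ge g b -> ge (f * g) (a + b).
Proof.
by rewrite /ge nuM; case: (nu f) (nu g) => [c|] [d|] //=; apply: leD2.
Qed.

Lemma gt_mul f g a b : ge f a -> gt g b -> gt (f * g) (a + b).
Proof.
case hf: (nu f) => [c|]; last by move=> _ _; apply: gt_None; rewrite nuM hf.
case hg: (nu g) => [d|]; last by move=> _ _; apply: gt_None; rewrite nuM hf hg.
rewrite (geE _ hf) (gtE _ hg) (@gtE _ _ (c + d)) ?nuM ?hf ?hg // => h.
apply: contra => h'; apply: (le_cert (c := (a + b - (c + d)) + (c - a))); last by zmod.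
by apply: nnD; apply: sub_le.
Qed.

Lemma ge_exp f a n : ge f a -> ge (f ^+ n) (a *+ n).
Proof.
move=> h; elim: n => [|n IH]; first by rewrite (geE _ nu1) le_refl.
by rewrite exprS mulrS ge_mul.
Qed.

Lemma ge_mulK f g a b : nu f = Some a -> ge (f * g) (a + b) -> ge g b.
Proof.
rewrite /ge nuM => ->; case: (nu g) => //= c h.
by apply: (le_cert (c := a + c - (a + b))); [apply: sub_le | zmod].
Qed.

Lemma nu_ge f a : nu f = Some a -> ge f a.
Proof. by move=> h; rewrite (geE _ h) le_refl. Qed.

Lemma nu_ngt f a : nu f = Some a -> ~~ gt f a.
Proof. by move=> h; rewrite (gtE _ h) negbK le_refl. Qed.

Lemma nu_addl f g a : nu f = Some a -> gt g a -> nu (f + g) = Some a.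
Proof.
move=> h hg; apply: ge_ngt; first by apply: ge_add; [apply: nu_ge | apply: gtW].
by apply: contra (nu_ngt h) => h'; rewrite -[f](addrK g) gt_sub.
Qed.

(** * Values in the divisible hull of the value group *)

Lemma in_GammaB g h : in_Gamma v g -> in_Gamma v h -> in_Gamma v (g - h).
Proof.
(* The index [n * k + n + k] is the predecessor of [n.+1 * k.+1]. *)
move=> [n [a ha]] [k [b hb]]; exists (n * k + n + k)%N, (a ^+ k.+1 / b ^+ n.+1).
rewrite vM (vX _ ha) (vV (vX _ hb)) /=; congr Some; zmod.
Qed.

Lemma in_Gamma_divn g n : in_Gamma v (g *+ n.+1) -> in_Gamma v g.
Proof.
by move=> [k [a ha]]; exists (n * k + n + k)%N, a; rewrite ha; congr Some; zmod.
Qed.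

(** The coefficient matrix has more rows than columns, so its left kernel is nonzero. *)
Lemma linear_relation n (r : 'I_n.+1 -> {poly K}) :
  (forall i, (size (r i) <= n)%N) ->
  exists c : 'I_n.+1 -> K, (exists i, c i != 0) /\ \sum_i c i *: r i = 0.
Proof.
move=> sr; pose A : 'M_(n.+1, n) := \matrix_(i < n.+1) poly_rV (r i).
have kn0 : kermx A != 0.
  by rewrite -mxrank_eq0 mxrank_ker subn_eq0 -ltnNge ltnS rank_leq_col.
have /sub_kermxP uA : (nz_row (kermx A) <= kermx A)%MS by apply: nz_row_sub.
move: uA; rewrite -nz_row_eq0 in kn0; move: kn0; set u := nz_row _ => un0 uA.
exists (u 0); split.
  by apply/existsP; rewrite -negb_forall; apply: contra un0 => /forallP h;
     apply/eqP/rowP => i; rewrite mxE; apply/eqP.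
have := congr1 rVpoly uA; rewrite mulmx_sum_row raddf_sum raddf0; apply: etrans.
by apply: eq_bigr => i _; rewrite /= linearZ /= rowK poly_rV_K.
Qed.

(* The powers of [f] modulo [M] are linearly dependent over [K]; two terms of a
   relation must have the same value, which makes [a] torsion modulo [vK]. *)
Lemma in_Gamma_powers (M f : {poly K}) n a :
  size M = n.+1 -> (forall i, nu (f ^+ i %% M) = Some (a *+ i)) -> in_Gamma v a.
Proof.
move=> sM hpow.
have M0 : M != 0 by rewrite -size_poly_eq0 sM.
have [c [[i0 ci0] csum]] : exists c : 'I_n.+1 -> K, (exists i, c i != 0) /\
    \sum_i c i *: (f ^+ i %% M) = 0.
  apply: linear_relation => i; have := ltn_modp (f ^+ i) M.
  by rewrite M0 sM ltnS.
pose C k := if insub k is Some i then c i else 0.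
have CE (i : 'I_n.+1) : C i = c i by rewrite /C valK.
pose t k := C k *: (f ^+ k %% M).
have nut k : nu (t k) = oadd (v (C k)) (Some (a *+ k)).
  by rewrite /t -mul_polyC nuM nuC hpow.
have sum0 : \sum_(k < n.+1) t k = 0.
  by rewrite -[RHS]csum; apply: eq_bigr => i _; rewrite /t CE.
have ti0 : nu (t i0) <> None.
  by rewrite nut CE; have [b ->] := v_fin ci0.
have [i [b [hi hib hmin hlast]]] := @mem_last_min (nu \o t) _ _ (ltn_ord i0) ti0.
rewrite /= in hib hmin hlast.
have [[k hki hk]|hno] := classic (exists2 k, (k < i)%N & nu (t k) = Some b).
  move: hk hib; rewrite !nut; case hCk: (v (C k)) => [x|] //=.
  case hCi: (v (C i)) => [y|] //= [hx] [hy].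
  exists (i - k).-1, (C k / C i); rewrite vM hCk (vV hCi) prednK ?subn_gt0 //=.
  congr Some; rewrite mulrnBr 1?ltnW //.
  by apply/eqP; rewrite subr_eq addrAC -subr_eq opprK hx addrC hy.
(* Otherwise the term [i] alone has the least value, and the sum cannot vanish. *)
have : gt (\sum_(k < n.+1 | k != Ordinal hi) t k) b.
  apply: gt_sum => k hk; case: (ltngtP k i) => hki.
  - apply: contraT => hg; case: hno; exists k => //.
    by apply: ge_ngt => //; apply: hmin.
  - by apply: hlast; rewrite hki ltn_ord.
  - by case/eqP: hk; apply: val_inj.
move/eqP: sum0; rewrite (bigD1 (Ordinal hi)) //= addr_eq0 => /eqP h.
by rewrite -gt_opp -h => /(negP (nu_ngt hib)).
Qed.

(** * Taylor expansions and Gauss-type bounds *)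

Definition taylor (f : {poly K}) : {poly {poly K}} := \poly_(s < size f) f^`N(s).

Lemma coef_taylor f s : (taylor f)`_s = f^`N(s).
Proof. by rewrite coef_poly; case: ltnP => // h; rewrite nderivn_poly0. Qed.

(** As an evaluation at x + y, [taylor] inherits additivity and multiplicativity. *)
Lemma taylorE f :
  taylor f = (map_poly (polyC \o polyC) f).['X%:P + 'X].
Proof.
rewrite (nderiv_taylor _ (mulrC _ _)).
rewrite size_map_inj_poly //; last by move=> x y /= /polyC_inj /polyC_inj.
rewrite /taylor poly_def; apply: eq_bigr => i _; rewrite -mul_polyC; congr (_ * _).
rewrite nderivn_map map_poly_comp horner_map /=; congr (_%:P).
by rewrite -[RHS]/(_ \Po 'X) comp_polyXr.
Qed.

Lemma taylorM f g : taylor (f * g) = taylor f * taylor g.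
Proof. by rewrite !taylorE rmorphM hornerM. Qed.

Lemma taylorD f g : taylor (f + g) = taylor f + taylor g.
Proof. by rewrite !taylorE rmorphD hornerD. Qed.

Lemma taylorX f n : taylor (f ^+ n) = taylor f ^+ n.
Proof. by rewrite !taylorE rmorphXn horner_exp. Qed.

Lemma taylor_sum (I : Type) (r : seq I) (P : pred I) (E : I -> {poly K}) :
  taylor (\sum_(i <- r | P i) E i) = \sum_(i <- r | P i) taylor (E i).
Proof.
apply: (big_morph taylor taylorD); apply/polyP => s.
by rewrite coef_taylor coef0 linear0.
Qed.

(** Lower bounds for the Gauss-type valuation in which y has weight [e]; the minimum over s is never
    formed. *)
Definition Gge e (P : {poly {poly K}}) c := forall s, ge P`_s (c - e *+ s).
Definition Ggt e (P : {poly {poly K}}) c := forall s, gt P`_s (c - e *+ s).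

Lemma Gge_add e P S c : Gge e P c -> Gge e S c -> Gge e (P + S) c.
Proof. by move=> h1 h2 s; rewrite coefD ge_add. Qed.

Lemma Ggt_add e P S c : Ggt e P c -> Ggt e S c -> Ggt e (P + S) c.
Proof. by move=> h1 h2 s; rewrite coefD gt_add. Qed.

Lemma Ggt0 e c : Ggt e 0 c.
Proof. by move=> s; rewrite coef0 gt0. Qed.

Lemma Ggt_le e P a b : le a b -> Ggt e P b -> Ggt e P a.
Proof.
move=> h hP s; apply: gt_le (hP s).
by apply: (le_cert (c := b - a)); [apply: sub_le | zmod].
Qed.

Lemma Gge_le e P a b : le a b -> Gge e P b -> Gge e P a.
Proof.
move=> h hP s; apply: ge_le (hP s).
by apply: (le_cert (c := b - a)); [apply: sub_le | zmod].
Qed.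

Lemma Gge_gt e P a b : ~~ le b a -> Gge e P b -> Ggt e P a.
Proof.
move=> h hP s; apply: ge_gt (hP s); apply: contra h => h.
by apply: (le_cert (c := (a - e *+ s) - (b - e *+ s))); [apply: sub_le | zmod].
Qed.

Lemma Gge_mul e P S a b : Gge e P a -> Gge e S b -> Gge e (P * S) (a + b).
Proof.
move=> h1 h2 s; rewrite coefM; apply: ge_sum => j _.
have -> : a + b - e *+ s = (a - e *+ j) + (b - e *+ (s - j)).
  by rewrite -{1}(subnKC (ltn_ord j : (j <= s)%N)); zmod.
exact: ge_mul.
Qed.

Lemma Ggt_mul e P S a b : Gge e P a -> Ggt e S b -> Ggt e (P * S) (a + b).
Proof.
move=> h1 h2 s; rewrite coefM; apply: gt_sum => j _.
have -> : a + b - e *+ s = (a - e *+ j) + (b - e *+ (s - j)).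
  by rewrite -{1}(subnKC (ltn_ord j : (j <= s)%N)); zmod.
exact: gt_mul.
Qed.

Lemma Gge_polyC e f a : ge f a -> Gge e f%:P a.
Proof. by move=> h [|s]; rewrite coefC /= ?ge0 // mulr0n subr0. Qed.

Lemma Gge1 e : Gge e 1 0.
Proof. by apply: Gge_polyC; apply: nu_ge nu1. Qed.

Lemma Gge_exp e P a n : Gge e P a -> Gge e (P ^+ n) (a *+ n).
Proof.
move=> h; elim: n => [|n IH]; first exact: Gge1.
by rewrite exprS mulrS; apply: Gge_mul.
Qed.

(** Telescoping: P^(n+1) - S^(n+1) = P (P^n - S^n) + S^n (P - S). Hence powers may be computed on
    leading parts. *)
Lemma Ggt_exp_sub e P S a n :
  Gge e P a -> Gge e S a -> Ggt e (P - S) a -> Ggt e (P ^+ n - S ^+ n) (a *+ n).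
Proof.
move=> hP hS hPS; elim: n => [|n IH]; first by rewrite subrr; apply: Ggt0.
have -> : P ^+ n.+1 - S ^+ n.+1 = P * (P ^+ n - S ^+ n) + S ^+ n * (P - S).
  by rewrite !exprS; ring.
rewrite mulrS; apply: Ggt_add; first exact: Ggt_mul.
by rewrite addrC; apply: Ggt_mul => //; apply: Gge_exp.
Qed.

Lemma coef_affine_exp (a b : {poly K}) j k : (j <= k)%N ->
  ((a%:P + b%:P * 'X) ^+ j)`_k = if k == j then b ^+ j else 0.
Proof.
elim: j k => [|j IH] [|k] //; first by rewrite coef1.
  by rewrite coef1.
rewrite ltnS eqSS => hk; rewrite exprS mulrDl coefD -mulrA !coefCM coefXM /=.
rewrite !IH ?(leqW hk) //; case: (k.+1 =P j) => [h|_]; first by lia.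
by rewrite mulr0 add0r; case: eqP => _; rewrite ?mulr0 // exprS.
Qed.

(** * Expansions in powers of a monic polynomial *)

Lemma size_monic_exp (Q : {poly K}) m n :
  Q \is monic -> size Q = m.+1 -> size (Q ^+ n) = (m * n).+1.
Proof.
move=> Qm sQ; have := size_exp Q n; rewrite sQ /= => <-.
by rewrite prednK // size_poly_gt0 expf_neq0 // monic_neq0.
Qed.

Lemma coefQ_size (Q f : {poly K}) m j :
  Q \is monic -> size Q = m.+1 -> (size (coefQ Q f j) <= m)%N.
Proof.
move=> Qm sQ; rewrite -ltnS -sQ /coefQ ltn_modp; exact: monic_neq0.
Qed.

Lemma coefQD (Q f g : {poly K}) j : coefQ Q (f + g) j = coefQ Q f j + coefQ Q g j.
Proof. by rewrite /coefQ divpD modpD. Qed.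

Lemma coefQ0 (Q : {poly K}) j : coefQ Q 0 j = 0.
Proof. by rewrite /coefQ div0p mod0p. Qed.

Lemma coefQ_sum (Q : {poly K}) j (I : Type) (r : seq I) (P : pred I) E :
  coefQ Q (\sum_(i <- r | P i) E i) j = \sum_(i <- r | P i) coefQ Q (E i) j.
Proof.
by apply: (big_morph (fun f => coefQ Q f j)) => [f g|]; rewrite (coefQD, coefQ0).
Qed.

Lemma coefQMn (Q f : {poly K}) j n : coefQ Q (f *+ n) j = coefQ Q f j *+ n.
Proof. by elim: n => [|n IH]; rewrite ?mulr0n ?coefQ0 // !mulrS coefQD IH. Qed.

Lemma coefQ_mulX (Q f : {poly K}) k j : Q \is monic ->
  coefQ Q (f * Q ^+ k) j = if (k <= j)%N then coefQ Q f (j - k) else 0.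
Proof.
move=> Qm; have Q0 : Q != 0 by apply: monic_neq0.
rewrite /coefQ; case: leqP => hk.
  by rewrite -{1}(subnK hk) exprD divp_pmul2r // expf_neq0.
have -> : f * Q ^+ k = (f * Q ^+ (k - j.+1) * Q) * Q ^+ j.
  by rewrite -!mulrA -exprS -exprD; congr (_ * _ ^+ _); lia.
by rewrite mulpK ?expf_neq0 // modp_mull.
Qed.

Lemma coefQ_eq0 (Q f : {poly K}) m j : Q \is monic -> size Q = m.+1 ->
  (size f <= m * j)%N -> coefQ Q f j = 0.
Proof.
by move=> Qm sQ sf; rewrite /coefQ divp_small ?mod0p // (size_monic_exp _ Qm sQ) ltnS.
Qed.

Lemma coefQ_small (Q f : {poly K}) m j : Q \is monic -> size Q = m.+1 ->
  (size f <= m)%N -> coefQ Q f j = if j == 0%N then f else 0.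
Proof.
move=> Qm sQ sf; case: eqP => [->|/eqP hj].
  by rewrite /coefQ expr0 divp1 modp_small // sQ ltnS.
by apply: (coefQ_eq0 Qm sQ); apply: leq_trans sf _; rewrite leq_pmulr // lt0n.
Qed.

Lemma coefQ_expand (Q f : {poly K}) m n : (0 < m)%N -> Q \is monic ->
  size Q = m.+1 -> (size f <= n)%N -> f = \sum_(j < n) coefQ Q f j * Q ^+ j.
Proof.
move=> m0 Qm sQ sf.
(* Partial expansion with the unexpanded quotient in front; at [k = n] this quotient is 0 because
   deg Q >= 1. *)
have step k : f = f %/ Q ^+ k * Q ^+ k + \sum_(j < k) coefQ Q f j * Q ^+ j.
  elim: k => [|k IH]; first by rewrite expr0 divp1 mulr1 big_ord0 addr0.
  rewrite big_ord_recr /= {1}IH {1}(divp_eq (f %/ Q ^+ k) Q) divp_divl -exprSr.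
  by rewrite /coefQ exprSr; ring.
rewrite {1}(step n) divp_small ?mul0r ?add0r // (size_monic_exp _ Qm sQ) ltnS.
by apply: leq_trans sf _; rewrite leq_pmull.
Qed.

(** * Leading parts in y *)

(** Levels below [e] in degrees less than [m]: the leading part in y is constant. Finiteness is
    included since [nu] may have nonzero support. *)
Definition low_level m e := forall f : {poly K}, f != 0 -> (size f <= m)%N ->
  exists2 a, nu f = Some a & forall s, (0 < s)%N -> gt f^`N(s) (a - e *+ s).

(** The leading part is Q + Q' y. Here [g] only bounds nu(Q) from below, so that later members of
    the family qualify at the weight of an earlier one. *)
Definition linear_at m e g (Q : {poly K}) :=
  [/\ Q \is monic, size Q = m.+1, ge Q g, nu Q^`N(1) = Some (g - e)
    & forall s, (1 < s)%N -> gt Q^`N(s) (g - e *+ s)].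

Lemma low_taylor m e (f : {poly K}) c : low_level m e -> (size f <= m)%N -> ge f c ->
  Gge e (taylor f) c.
Proof.
move=> hl sf hf s; rewrite coef_taylor.
have [->|f0] := eqVneq f 0; first by rewrite linear0 ge0.
case: s => [|s]; first by rewrite nderivn0 mulr0n subr0.
have [a ha /(_ s.+1 isT) hs] := hl f f0 sf.
apply: ge_le (gtW hs); rewrite (geE _ ha) in hf.
by apply: (le_cert (c := a - c)); [apply: sub_le | zmod].
Qed.

Lemma low_taylor_sub m e (f : {poly K}) a : low_level m e -> (size f <= m)%N -> nu f = Some a ->
  Ggt e (taylor f - f%:P) a.
Proof.
move=> hl sf hf s; rewrite coefB coef_taylor coefC.
have f0 : f != 0 by apply/eqP => f0; move: hf; rewrite f0 nu0.
case: s => [|s] /=; first by rewrite nderivn0 subrr gt0.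
have [b hb /(_ s.+1 isT) hs] := hl f f0 sf.
by rewrite subr0; move: hs; have -> : b = a by move: hb; rewrite hf => -[].
Qed.

Lemma linear_taylor m e g Q : linear_at m e g Q -> Gge e (taylor Q) g.
Proof.
move=> [_ _ h0 h1 h2] [|[|s]]; rewrite coef_taylor.
- by rewrite nderivn0 mulr0n subr0.
- by rewrite mulr1n; apply: nu_ge.
- by apply/gtW/h2.
Qed.

Lemma linear_taylor_sub m e g Q : linear_at m e g Q ->
  Ggt e (taylor Q - (Q%:P + Q^`N(1)%:P * 'X)) g.
Proof.
move=> [_ _ h0 h1 h2] [|[|s]]; rewrite coefB coefD coef_taylor coefCM coefC coefX /=.
- by rewrite nderivn0 mulr0 addr0 subrr gt0.
- by rewrite mulr1 add0r subrr gt0.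
- by rewrite mulr0 addr0 subr0; apply: h2.
Qed.

Lemma linear_affine m e g Q : linear_at m e g Q ->
  Gge e (Q%:P + Q^`N(1)%:P * 'X) g.
Proof.
move=> hQ; rewrite -[X in Gge _ X](subKr (taylor Q)); apply: Gge_add.
  exact: linear_taylor hQ.
by move=> s; rewrite coefN ge_opp; apply/gtW/(linear_taylor_sub hQ).
Qed.

(* Let [b] be the least value of [f_j] with [Q] weighted by [g], and [i] the last
   index attaining it: the coefficient of [y^i] in [f(x + y)] has the same leading
   term as [f_i * (Q')^i], hence value exactly [b - i e]. *)
Lemma taylor_coefQ m e g Q f c j : (0 < m)%N -> low_level m e -> linear_at m e g Q ->
  Gge e (taylor f) c -> ge (coefQ Q f j) (c - g *+ j).
Proof.
move=> m0 hl hQ hf; have [Qm sQ _ hq _] := hQ.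
set q := Q^`N(1) in hq; pose A := Q%:P + q%:P * 'X.
case: (leqP (size f) j) => hj.
  rewrite (coefQ_eq0 Qm sQ) ?ge0 //.
  by apply: leq_trans hj _; rewrite leq_pmull.
apply: contraT => hneg; pose F k := coefQ Q f k.
have sF k : (size (F k) <= m)%N by apply: coefQ_size.
have fin k : nu (F k) = None -> F k = 0.
  move=> hk; apply/eqP; apply: contraT => nz.
  by have [a] := hl _ nz (sF k); rewrite hk.
pose val k := oadd (nu (F k)) (Some (g *+ k)).
have valj : val j <> None.
  by move: hneg; rewrite /val /ge -/(F j); case: (nu (F j)).
have [i [b [hi hib hmin hlast]]] := mem_last_min hj valj.
have hcb : ~~ le c b.
  move: (hmin j hj) hneg; rewrite /val /ge -/(F j).
  case: (nu (F j)) => //= x h1; apply: contra => h2; have h3 := le_tr h2 h1.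
  by apply: (le_cert (c := x + g *+ j - c)); [apply: sub_le | zmod].
(* Each term f_k Q^k may be replaced by f_k A^k, with an error strictly above [b]. *)
have lead k : (k < size f)%N -> Ggt e (taylor (F k * Q ^+ k) - (F k)%:P * A ^+ k) b.
  move=> hk; have := hmin k hk; rewrite /val.
  case hFk: (nu (F k)) => [a|] /=; last first.
    by rewrite (fin k hFk) mul0r !mul0r subr0 => _ s; rewrite coef_taylor linear0 gt0.
  move=> hb; apply: Ggt_le hb _; rewrite taylorM taylorX.
  have -> : taylor (F k) * taylor Q ^+ k - (F k)%:P * A ^+ k =
     taylor Q ^+ k * (taylor (F k) - (F k)%:P) + (F k)%:P * (taylor Q ^+ k - A ^+ k).
    by ring.
  apply: Ggt_add.
    rewrite [a + _]addrC; apply: Ggt_mul; first by apply: Gge_exp; apply: linear_taylor hQ.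
    exact: (low_taylor_sub hl).
  apply: Ggt_mul; first by apply: Gge_polyC; apply: nu_ge.
  apply: Ggt_exp_sub; first exact: linear_taylor hQ.
    exact: linear_affine hQ.
  exact: linear_taylor_sub hQ.
(* For k < i the degree in y is too small to reach y^i; for k > i the term is strictly larger by the
   choice of [i]. *)
have other k : (k < size f)%N -> k != i -> gt ((F k)%:P * A ^+ k)`_i (b - e *+ i).
  move=> hk; case: ltngtP => // hki _.
    by rewrite coefCM coef_affine_exp ?(ltnW hki) // gtn_eqF // mulr0 gt0.
  have := hlast k; rewrite hki hk /val => /(_ isT).
  case hFk: (nu (F k)) => [a|] /=; last by rewrite (fin k hFk) mul0r coef0 gt0.
  move=> hb; suff : Ggt e ((F k)%:P * A ^+ k) b by [].
  apply: (@Gge_gt e _ _ (a + g *+ k)); first by case/andP: hb.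
  apply: Gge_mul; first by apply: Gge_polyC; apply: nu_ge.
  by apply: Gge_exp; apply: linear_affine hQ.
(* Since [c] exceeds [b], the assumption on f(x + y) forces the surviving term above its own
   value. *)
have main : gt (F i * q ^+ i) (b - e *+ i).
  have -> : F i * q ^+ i = ((F i)%:P * A ^+ i)`_i.
    by rewrite coefCM coef_affine_exp // eqxx.
  have := hf i; rewrite {1}(coefQ_expand m0 Qm sQ (leqnn (size f))) taylor_sum.
  set S := \sum_(k < _) _ => hS.
  have {}hS : gt S`_i (b - e *+ i).
    apply: ge_gt hS; apply: contra hcb => h.
    by apply: (le_cert (c := (b - e *+ i) - (c - e *+ i))); [apply: sub_le | zmod].
  rewrite -[X in gt X](subKr S`_i); apply: gt_sub => //.
  rewrite /S coef_sum (bigD1 (Ordinal hi)) //= addrAC; apply: gt_add.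
    by rewrite -coefB; apply: lead.
  apply: gt_sum => k hk; rewrite -[X in gt X](subrK ((F k)%:P * A ^+ k)`_i).
  apply: gt_add; last by apply: other.
  by rewrite -coefB; apply: lead.
have : nu (F i * q ^+ i) = Some (b - e *+ i).
  move: hib; rewrite /val nuM (nuX _ hq); case: (nu (F i)) => //= x [<-].
  by congr Some; zmod.
by move/nu_ngt; rewrite main.
Qed.

(** Converse of [taylor_coefQ], by multiplicativity of Gauss bounds; the two together compute N from
    the Q-expansion. *)
Lemma coefQ_taylor m e g Q f c : (0 < m)%N -> low_level m e -> linear_at m e g Q ->
  (forall j, ge (coefQ Q f j) (c - g *+ j)) -> Gge e (taylor f) c.
Proof.
move=> m0 hl hQ h; have [Qm sQ _ _ _] := hQ.
rewrite (coefQ_expand m0 Qm sQ (leqnn (size f))) taylor_sum => s; rewrite coef_sum.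
apply: ge_sum => j _; suff : Gge e (taylor (coefQ Q f j * Q ^+ j)) c by [].
rewrite taylorM taylorX; have -> : c = (c - g *+ j) + g *+ j by zmod.
apply: Gge_mul; first by apply: low_taylor; [exact: hl | exact: coefQ_size | ].
by apply: Gge_exp; apply: linear_taylor hQ.
Qed.

Lemma ole_nuQ (Q f : {poly K}) g c m : (0 < m)%N -> Q \is monic -> size Q = m.+1 -> nu Q = Some g ->
  ole le (Some c) (nuQ le nu Q f) <-> forall j, ge (coefQ Q f j) (c - g *+ j).
Proof.
move=> m0 Qm sQ hQ.
have term j : ge (coefQ Q f j * Q ^+ j) c = ge (coefQ Q f j) (c - g *+ j).
  apply/idP/idP => h.
    by apply: (ge_mulK (nuX j hQ)); rewrite mulrC addrC subrK.
  have -> : c = (c - g *+ j) + g *+ j by zmod.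
  by apply: ge_mul => //; apply/ge_exp/nu_ge.
(* Being bounded below by [c] turns the minimum into a conjunction. *)
have morph : {morph ole le (Some c) : x y / omin le x y >-> x && y}.
  move=> x y; rewrite /omin; case: ifP => hxy.
    case: (boolP (ole le (Some c) x)) => //= hcx; apply/esym.
    case: x y hxy hcx => [x|] [y|] //= hxy hcx; exact: le_tr hxy.
  rewrite andbC; case: (boolP (ole le (Some c) y)) => //= hcy; apply/esym.
  case: x y hxy hcy => [x|] [y|] //= hxy hcy; apply: le_tr hcy _.
  by apply: nle_le; rewrite hxy.
rewrite /nuQ (big_morph _ morph (erefl : ole le (Some c) None = true)) big_andE.
split=> [/forallP h j|h]; last by apply/forallP => j; rewrite -/(ge _ _) term; apply: h.
case: (ltnP j (size f)) => hj; first by have := h (Ordinal hj); rewrite -/(ge _ _) term.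
rewrite (coefQ_eq0 Qm sQ) ?ge0 //; apply: leq_trans hj _; exact: leq_pmull.
Qed.

(** * Levels and key polynomials *)

Lemma mle_bigmax (I : eqType) (r : seq I) (E : I -> option L) i :
  i \in r -> mle le (E i) (\big[mmax le/None]_(k <- r) E k).
Proof.
have mle_max x y : mle le x (mmax le x y) /\ mle le y (mmax le x y).
  rewrite /mmax; case: ifP => h; split=> //; first by case: y {h} => //= ?; apply: le_refl.
    by case: x {h} => //= ?; apply: le_refl.
  by case: x y h => [x|] [y|] //= h; apply: nle_le; rewrite h.
elim: r => // k r IH; rewrite inE big_cons => /orP[/eqP->|/IH h].
  by case: (mle_max (E k) (\big[mmax le/None]_(k <- r) E k)).
case: (mle_max (E k) (\big[mmax le/None]_(k <- r) E k)) => _.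
move: h; case: (E i) (\big[mmax le/None]_(k <- r) E k) (mmax le _ _) => [x|] [y|] [z|] //=.
exact: le_tr.
Qed.

Lemma bigmax_attained (I : eqType) (r : seq I) (E : I -> option L) e :
  \big[mmax le/None]_(k <- r) E k = Some e -> exists2 i, i \in r & E i = Some e.
Proof.
elim: r => [|k r IH]; first by rewrite big_nil.
rewrite big_cons /mmax; case: ifP => _ h; last by exists k; rewrite ?mem_head.
by have [i hi hE] := IH h; exists i; rewrite // inE hi orbT.
Qed.

Lemma scale_divn (x : L) s : (0 < s)%N -> ((s%:R : rat)^-1 *: x) *+ s = x.
Proof.
move=> hs; rewrite -scaler_nat scalerA mulfV ?scale1r //.
by rewrite Num.Theory.pnatr_eq0 -lt0n.
Qed.

Lemma le_level f a b s : (0 < s < size f)%N -> nu f = Some a -> nu f^`N(s) = Some b ->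
  exists2 l, level le nu f = Some l & le (a - b) (l *+ s).
Proof.
move=> /andP[s0 sf] ha hb.
have : mle le (level_term nu f s) (level le nu f).
  rewrite /level leqNgt (leq_ltn_trans s0 sf) /=.
  by apply: mle_bigmax; rewrite mem_index_iota s0.
rewrite /level_term ha hb; case: (level le nu f) => //= l hl; exists l => //.
by rewrite -(scale_divn (a - b) s0); apply: leMn.
Qed.

Lemma level_attained f e : level le nu f = Some e ->
  exists s, [/\ (0 < s < size f)%N, level_term nu f s = Some e
    & exists a b, [/\ nu f = Some a, nu f^`N(s) = Some b & e *+ s = a - b]].
Proof.
rewrite /level; case: ifP => // _ /bigmax_attained[s].
rewrite mem_index_iota => hs hE; exists s; split=> //.
move: hE; rewrite /level_term; case: (nu f) => [a|] //; case: (nu f^`N(s)) => [b|] // [<-].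
by exists a, b; rewrite scale_divn //; case/andP: hs.
Qed.

Lemma level_ge f a e s : nu f = Some a -> level le nu f = Some e -> (0 < s)%N ->
  ge f^`N(s) (a - e *+ s).
Proof.
move=> ha he s0; case: (ltnP s (size f)) => sf; last by rewrite nderivn_poly0 // ge0.
case hb: (nu f^`N(s)) => [b|]; last exact: ge_None.
have [|l] := @le_level f a b s _ ha hb; first by rewrite s0.
rewrite he => -[<-] h; rewrite (geE _ hb).
by apply: (le_cert (c := e *+ s - (a - b))); [apply: sub_le | zmod].
Qed.

Lemma level_gt f a e s : nu f = Some a -> mlt le (level le nu f) (Some e) ->
  (0 < s)%N -> gt f^`N(s) (a - e *+ s).
Proof.
move=> ha he s0; case: (ltnP s (size f)) => sf; last by rewrite nderivn_poly0 // gt0.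
case hb: (nu f^`N(s)) => [b|]; last exact: gt_None.
have [|l hl h] := @le_level f a b s _ ha hb; first by rewrite s0.
move: he; rewrite hl /mlt /= => /andP[_]; rewrite (gtE _ hb); apply: contra => h'.
case: s s0 h h' {sf hb} => // s _ h h'; apply: (@leMn_cancel _ _ s).
apply: (le_cert (c := (l *+ s.+1 - (a - b)) + ((a - e *+ s.+1) - b))); last by zmod.
by apply: nnD; apply: sub_le.
Qed.

Lemma key_poly_level Q : key_poly le nu Q -> (1 < size Q)%N ->
  exists2 e, level le nu Q = Some e & exists g, nu Q = Some g.
Proof.
move=> [_ hQ hlev] sQ; case: (nu Q) hQ => [g|] // _.
(* The polynomial 0 has level -oo, and the strict inequality makes the level of [Q] finite. *)
have := hlev 0; rewrite size_poly0 (ltnW sQ) => /(_ isT (or_intror isT)).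
by rewrite {1}/level size_poly0 /=; case: (level le nu Q) => // e _; exists e => //; exists g.
Qed.

Lemma support_monic f : f != 0 -> nu f = None ->
  exists g : {poly K}, [/\ g \is monic, nu g = None & size g = size f].
Proof.
move=> f0 hf; have lf0 : (lead_coef f)^-1 != 0 by rewrite invr_eq0 lead_coef_eq0.
exists ((lead_coef f)^-1 *: f); split; last by rewrite size_scale.
- by rewrite monicE lead_coefZ mulVf // lead_coef_eq0.
- by rewrite -mul_polyC nuM hf; case: (nu _).
Qed.

(** Reduction modulo [g] subtracts elements of infinite value, so powers of [f] keep their values
    and [in_Gamma_powers] applies. *)
Lemma in_Gamma_support g f a : g \is monic -> nu g = None -> nu f = Some a ->
  in_Gamma v a.
Proof.
move=> gm hg hf; have [n sg] : exists n, size g = n.+1.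
  by exists (size g).-1; rewrite prednK // size_poly_gt0 monic_neq0.
apply: (in_Gamma_powers (M := g) (f := f) sg) => i.
have := nuX i hf; rewrite {1}(divp_eq (f ^+ i) g) addrC => h.
rewrite -[_ %% _](addrK (f ^+ i %/ g * g)); apply: nu_addl => //.
by rewrite gt_opp; apply: gt_None; rewrite nuM hg; case: (nu _).
Qed.

(* If some nonzero [g] of degree less than [m] had infinite value, all finite
   values would lie in [Gamma], and [g + c] with [v c] large would have a level
   exceeding that of the key polynomial. *)
Lemma key_poly_finite m Q f : (0 < m)%N -> Psi le nu m Q -> f != 0 ->
  (size f <= m)%N -> nu f <> None.
Proof.
move=> m0 [hQ sQ] f0 sf /(support_monic f0)[g [gm hg sg]].
have [|e he [gq hgq]] := key_poly_level hQ; first by rewrite sQ ltnS.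
have [n [c0 hc0]] : in_Gamma v e.
  have [s [/andP[s0 _] _ [a [b [ha hb hs]]]]] := level_attained he.
  case: s s0 hs {hb} (hb) => // s _ hs hb; apply: (@in_Gamma_divn _ s); rewrite hs.
  by apply: in_GammaB; apply: in_Gamma_support; eassumption.
have g1 : (1 < size g)%N.
  rewrite ltnNge; apply/negP => /size1_polyC hgc; move: hg; rewrite hgc nuC.
  have [|x ->] // := @v_fin g`_0.
  by rewrite -polyC_eq0 -hgc monic_neq0.
pose d := (size g).-1.
have d0 : (0 < d)%N by rewrite /d; case: (size g) g1 => [|[]].
have gd : g^`N(d) = 1.
  apply/polyP => i; rewrite coef_nderivn coef1; case: i => [|i].
    by rewrite addn0 binn mulr1n; apply/eqP.
  rewrite nth_default ?mul0rn // /d addnS; case: (size g) g1 => // k _; lia.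
(* As nu(g) is infinite, g + c has value w; its derivative of order d is 1, so a level below [e]
   means w < d e. *)
have test c w : v c = Some w -> ~~ le 0 (w - e *+ d).
  move=> hc; have hcg : nu (g + c%:P) = Some w.
    by rewrite addrC; apply: nu_addl; [rewrite nuC | apply: gt_None].
  have sgc : size (g + c%:P) = size g.
    by rewrite size_polyDl //; apply: leq_ltn_trans g1; apply: size_polyC_leq1.
  case: hQ => _ _ /(_ (g + c%:P)); rewrite sgc sQ ltnS sg sf hcg he.
  move=> /(_ isT (or_introl _)) hlt.
  have := level_gt hcg (hlt _) d0; rewrite nderivnD gd nderivnC gtn_eqF // addr0.
  by rewrite (gtE _ nu1); apply.
have e0 : le 0 e.
  have := test 1 0 v1; case: (boolP (le 0 e)) => // /nle_le h; rewrite sub0r => /negP[].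
  by apply: (le_cert (c := (0 - e) *+ d)); [apply/nnMn/sub_le | zmod].
(* The constant [c0 ^+ d] has value (n + 1) d e >= d e, against [test]. *)
have /negP[] := test _ _ (vX d hc0).
by apply: (le_cert (c := e *+ (n * d))); [apply: nnMn | zmod].
Qed.

Lemma key_poly_low m Q e : (0 < m)%N -> Psi le nu m Q -> level le nu Q = Some e ->
  low_level m e.
Proof.
move=> m0 hQ he f f0 sf.
have hfin := key_poly_finite m0 hQ f0 sf; case ha: (nu f) hfin => [a|] // _.
exists a => // s; apply: level_gt => //; rewrite -he; case: hQ => -[_ _ +] sQ; apply.
  by rewrite sQ ltnS.
by left; rewrite ha.
Qed.

Lemma key_poly_linear m Q : (0 < m)%N -> Psi le nu m Q ->
  (forall s, Iset le nu Q s <-> s = 1%N) ->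
  exists e g, [/\ level le nu Q = Some e, nu Q = Some g, low_level m e
    & linear_at m e g Q].
Proof.
move=> m0 hQ hI; have [[Qm Qfin Qlev] sQ] := hQ.
have [||e he [g hg]] := @key_poly_level Q => //; first by rewrite sQ ltnS.
exists e, g; split=> //; first exact: key_poly_low hQ he.
split=> //; first exact: nu_ge.
  have [_] := (hI 1%N).2 erefl; rewrite he /level_term hg.
  case: (nu _) => // b [<-]; congr Some.
  by rewrite invr1 scale1r; zmod.
move=> s hs; have s0 : (0 < s)%N by apply: ltnW.
(* Equality at some s > 1 would put s into I(Q). *)
apply: contraT => hng.
have hs2 := ge_ngt (level_ge hg he s0) hng.
suff : s = 1%N by lia.
apply/(hI s); split=> //; rewrite he /level_term hg hs2; congr Some.
have -> : g - (g - e *+ s) = e *+ s by zmod.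
rewrite -scaler_nat scalerA mulVf ?scale1r //.
by rewrite Num.Theory.pnatr_eq0 -lt0n.
Qed.

(** * Comparison of key polynomials of equal degree *)

Lemma size_monic_sub (Q R : {poly K}) m : Q \is monic -> R \is monic ->
  size Q = m.+1 -> size R = m.+1 -> (size (R - Q)%R <= m)%N.
Proof.
move=> Qm Rm sQ sR; apply/leq_sizeP => j; rewrite leq_eqVlt coefB => /orP[/eqP<-|hj].
  move: Qm Rm; rewrite !monicE /lead_coef sQ sR /= => /eqP-> /eqP->; exact: subrr.
by rewrite !nth_default ?subrr ?sQ ?sR.
Qed.

(* The difference [Q - Q0] has degree less than [m] and value at least [g0], so
   it does not affect the leading part of [Q0(x + y)]. *)
Lemma linear_transfer m Q0 Q e0 g0 e g : low_level m e0 -> linear_at m e0 g0 Q0 ->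
  linear_at m e g Q -> nu Q = Some g -> le g0 g ->
  linear_at m e0 g0 Q /\ e = e0 + (g - g0).
Proof.
move=> hl [Q0m sQ0 hQ0 h01 h0s] [Qm sQ _ h1 _] hg h.
have sd := size_monic_sub Q0m Qm sQ0 sQ.
have gQ : ge Q g0 by rewrite (geE _ hg).
have hd : ge (Q - Q0) g0 by apply: ge_sub.
have hds s : (0 < s)%N -> gt (Q - Q0)^`N(s) (g0 - e0 *+ s).
  move=> s0; have [->|d0] := eqVneq (Q - Q0) 0; first by rewrite linear0 gt0.
  have [a ha /(_ s s0)] := hl _ d0 sd; apply: gt_le.
  rewrite (geE _ ha) in hd.
  by apply: (le_cert (c := a - g0)); [apply: sub_le | zmod].
have QE : Q = Q0 + (Q - Q0) by rewrite addrC subrK.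
have hQ1 : nu Q^`N(1) = Some (g0 - e0).
  by rewrite QE nderivnD; apply: nu_addl => //; have := hds 1%N isT; rewrite mulr1n.
split; last first.
  by move: hQ1; rewrite h1 => -[E]; have -> : e = g - (g - e); [zmod | rewrite E; zmod].
split=> // s hs; rewrite QE nderivnD; apply: gt_add; first exact: h0s.
by apply: hds; apply: ltnW.
Qed.

Lemma Gge_eps e e' P c : le e e' -> Gge e P c -> Gge e' P c.
Proof.
move=> h hP s; apply: ge_le (hP s).
by apply: (le_cert (c := (e' - e) *+ s)); [apply/nnMn/sub_le | zmod].
Qed.

Lemma size_mul_exp (f a : {poly K}) m i : (size f <= m)%N -> (size a <= m)%N ->
  (size (f * a ^+ i)%R <= m * i.+1)%N.
Proof.
move=> sf sa; elim: i => [|i IH]; first by rewrite expr0 mulr1 muln1.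
rewrite exprSr mulrA mulnS addnC.
have [->|a0] := eqVneq a 0; first by rewrite mulr0 size_poly0.
by apply: leq_trans (size_polyMleq _ _) _; apply: leq_trans (leq_pred _) (leq_add IH sa).
Qed.

Lemma least_nat (P : nat -> Prop) n : P n ->
  exists2 k, P k & forall i, (i < k)%N -> ~ P i.
Proof.
have [k] := ubnP n; elim: k n => // k IH n hn Pn.
have [[i hi Pi]|hno] := classic (exists2 i, (i < n)%N & P i).
  by apply: (IH i) Pi; apply: leq_trans hi _.
by exists n => // i hi Pi; apply: hno; exists i.
Qed.

(** * Change of base along a tail of the family *)

Section Tail.
Variables (m : nat) (T : {poly K} -> Prop) (Q0 : {poly K}) (d : L).
Hypothesis m_gt0 : (0 < m)%N.

Definition gam Q : L := odflt 0 (nu Q).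
(** [d] is the common value of the derivatives Q' on the tail. *)
Definition eps Q : L := gam Q - d.
Definition off Q : L := gam Q - gam Q0.

Hypothesis T_nu : forall Q, T Q -> nu Q = Some (gam Q).
Hypothesis T_low : forall Q, T Q -> low_level m (eps Q).
Hypothesis T_lin : forall Q R, T Q -> T R -> le (gam Q) (gam R) ->
  linear_at m (eps Q) (gam Q) R.
Hypothesis T_Q0 : T Q0.
Hypothesis T_min : forall Q, T Q -> le (gam Q0) (gam Q).

Lemma T_monic Q : T Q -> Q \is monic.
Proof. by move=> hQ; case: (T_lin T_Q0 hQ (T_min hQ)). Qed.

Lemma T_size Q : T Q -> size Q = m.+1.
Proof. by move=> hQ; case: (T_lin T_Q0 hQ (T_min hQ)). Qed.

Lemma off_ge0 Q : T Q -> le 0 (off Q).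
Proof. by move=> /T_min/sub_le. Qed.

Lemma T_sub_size Q R : T Q -> T R -> (size (R - Q)%R <= m)%N.
Proof.
by move=> hQ hR; apply: size_monic_sub; rewrite ?T_monic ?T_size.
Qed.

Lemma T_nuQ Q f c : T Q -> ole le (Some c) (nuQ le nu Q f) <-> Gge (eps Q) (taylor f) c.
Proof.
move=> hQ; have hlin := T_lin hQ hQ (le_refl _).
rewrite (ole_nuQ _ _ m_gt0 (T_monic hQ) (T_size hQ) (T_nu hQ)).
split=> [h|h j]; first exact: (coefQ_taylor m_gt0 (T_low hQ) hlin).
exact: (taylor_coefQ _ m_gt0 (T_low hQ) hlin).
Qed.

(* For [j < l] the degree of [f (R - Q)^i] is too small to reach [Q^l]. *)
Lemma rebase_term_ge Q R f l j i c : T Q -> T R -> le (gam Q) (gam R) ->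
  (size f <= m)%N -> (i <= j)%N ->
  ((l <= j <= l + i)%N -> ge f (c - gam Q0 *+ j)) ->
  ge (coefQ Q (f * (R - Q) ^+ i * Q ^+ (j - i)) l) (c - gam Q0 *+ l + off Q *+ i).
Proof.
move=> hQ hR hQR sf hij hf; have sa := T_sub_size hQ hR.
rewrite coefQ_mulX ?T_monic //; case: leqP => hk; last exact: ge0.
case: (ltnP j l) => hjl.
  rewrite (coefQ_eq0 (T_monic hQ) (T_size hQ)) ?ge0 //.
  apply: leq_trans (size_mul_exp i sf sa) _; rewrite leq_mul2l; apply/orP; right; lia.
have {}hf : ge f (c - gam Q0 *+ j) by apply: hf; lia.
have ha : ge (R - Q) (gam Q).
  apply: ge_sub; last by apply: nu_ge; apply: T_nu.
  by rewrite (geE _ (T_nu hR)).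
have hlow := T_low T_Q0.
(* At the weight of [Q0], a factor [R - Q] contributes [gam Q] while a power of [Q] counts only
   [gam Q0]; the surplus is [off Q] per factor. *)
have := @taylor_coefQ m (eps Q0) (gam Q0) Q (f * (R - Q) ^+ i)
  (c - gam Q0 *+ j + gam Q *+ i) (l - (j - i)) m_gt0 hlow (T_lin T_Q0 hQ (T_min hQ)).
have -> : c - gam Q0 *+ l + off Q *+ i =
    c - gam Q0 *+ j + gam Q *+ i - gam Q0 *+ (l - (j - i)).
  have [k ->] : exists k, l = (k + (j - i))%N by exists (l - (j - i))%N; lia.
  rewrite addnK /off; have [r ->] : exists r, j = (r + i)%N by exists (j - i)%N; lia.
  by rewrite addnK; zmod.
apply; rewrite taylorM taylorX; apply: Gge_mul; first exact: (low_taylor hlow).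
by apply: Gge_exp; apply: (low_taylor hlow).
Qed.

(** The other terms of the Q-expansion exceed [a] by at least a positive multiple of [off Q]. *)
Lemma nu_coefQ0 Q f a : T Q -> ~~ le (gam Q) (gam Q0) -> nu f = Some a ->
  Gge (eps Q0) (taylor f) a -> nu (coefQ Q f 0) = Some a.
Proof.
move=> hQ hQ0 ha hG.
have hk k := taylor_coefQ k m_gt0 (T_low T_Q0) (T_lin T_Q0 hQ (T_min hQ)) hG.
have -> : coefQ Q f 0 = f - \sum_(k < size f) coefQ Q f k.+1 * Q ^+ k.+1.
  rewrite {2}(coefQ_expand m_gt0 (T_monic hQ) (T_size hQ) (leqnSn (size f))).
  by rewrite big_ord_recl expr0 mulr1 addrK.
apply: nu_addl => //; rewrite gt_opp; apply: gt_sum => k _.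
have := ge_mul (hk k.+1) (ge_exp k.+1 (nu_ge (T_nu hQ))).
apply: ge_gt; apply: contra hQ0 => h; apply: (@leMn_cancel _ _ k).
by apply: (le_cert (c := a - (a - gam Q0 *+ k.+1 + gam Q *+ k.+1))); [apply: sub_le | zmod].
Qed.

Lemma T_sub_nu Q R : T Q -> T R -> ~~ le (gam R) (gam Q) -> nu (R - Q) = Some (gam Q).
Proof.
move=> hQ hR hRQ; rewrite addrC; apply: nu_addl; first by rewrite nuN; apply: T_nu.
by rewrite (gtE _ (T_nu hR)).
Qed.

(** All factors have degree less than [m], so the Gauss bound of the product equals its value and
    reduction modulo [Q] preserves it. *)
Lemma rebase_leading Q R f i c : T Q -> T R -> ~~ le (gam Q) (gam Q0) ->
  ~~ le (gam R) (gam Q) -> (size f <= m)%N ->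
  ge (coefQ Q (f * (R - Q) ^+ i) 0) c -> ge f (c - gam Q *+ i).
Proof.
move=> hQ hR hQ0 hRQ sf hc.
have [->|f0] := eqVneq f 0; first exact: ge0.
have hlow := T_low T_Q0; have [b hb _] := hlow f f0 sf.
have ha := T_sub_nu hQ hR hRQ.
have hP : nu (f * (R - Q) ^+ i) = Some (b + gam Q *+ i) by rewrite nuM hb (nuX _ ha).
have hG : Gge (eps Q0) (taylor (f * (R - Q) ^+ i)) (b + gam Q *+ i).
  rewrite taylorM taylorX; apply: Gge_mul; first by apply: (low_taylor hlow sf (nu_ge hb)).
  apply: Gge_exp; apply: (low_taylor hlow (T_sub_size hQ hR)).
  exact: nu_ge.
move: hc; rewrite (geE _ (nu_coefQ0 hQ hQ0 hP hG)) (geE _ hb) => hc.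
by apply: (le_cert (c := b + gam Q *+ i - c)); [apply: sub_le | zmod].
Qed.

Hypothesis T_nomax : forall Q, T Q -> exists2 R, T R & ~~ le (gam R) (gam Q).

(** By [nu_coefQ0], the powers of [f] keep their values modulo [Q]. *)
Lemma low_in_Gamma f a : (size f <= m)%N -> nu f = Some a -> in_Gamma v a.
Proof.
move=> sf ha; have [Q hQ hQ0] := T_nomax T_Q0.
apply: (in_Gamma_powers (f := f) (T_size hQ)) => i.
have -> : f ^+ i %% Q = coefQ Q (f ^+ i) 0 by rewrite /coefQ expr0 divp1.
apply: nu_coefQ0 => //; first exact: nuX.
by rewrite taylorX; apply: Gge_exp; apply: (low_taylor (T_low T_Q0)) => //; apply: nu_ge.
Qed.

(** [gam Q] is also the value of [R - Q], of degree less than [m], for a later [R]. *)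
Lemma gam_in_Gamma Q : T Q -> in_Gamma v (gam Q).
Proof.
move=> hQ; have [R hR hRQ] := T_nomax hQ.
exact: low_in_Gamma (T_sub_size hQ hR) (T_sub_nu hQ hR hRQ).
Qed.

(** The form in which vertical unboundedness and v(p) in H enter: offsets absorb doubling and the
    values of positive integers. *)
Hypothesis T_double : forall Q, T Q -> exists2 R, T R & le (off Q *+ 2) (off R).
Hypothesis T_char : forall n, (0 < n)%N ->
  exists w, v n%:R = Some w /\ exists2 R, T R & le w (off R).

Lemma T_max Q R : T Q -> T R -> exists P, [/\ T P, le (gam Q) (gam P) & le (gam R) (gam P)].
Proof.
move=> hQ hR; case: (boolP (le (gam Q) (gam R))) => [h|/nle_le h].
  by exists R; rewrite h le_refl.
by exists Q; rewrite h le_refl.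
Qed.

Lemma off_le Q R : le (gam Q) (gam R) -> le (off Q) (off R).
Proof. by move=> h; apply: leD2 => //; apply: le_refl. Qed.

Lemma off_add Q R : T Q -> T R -> exists P, T P /\ le (off Q + off R) (off P).
Proof.
move=> hQ hR; have [P [hP h1 h2]] := T_max hQ hR.
have [S hS h] := T_double hP; exists S; split=> //; apply: le_tr h.
by rewrite mulr2n; apply: leD2; apply: off_le.
Qed.

Lemma off_muln Q n : T Q -> exists P, T P /\ le (off Q *+ n) (off P).
Proof.
move=> hQ; elim: n => [|n [P [hP h]]].
  by exists Q; split=> //; rewrite mulr0n; apply: off_ge0.
have [S [hS h']] := off_add hQ hP; exists S; split=> //; apply: le_tr h'.
by rewrite mulrS; apply: leD2 => //; apply: le_refl.
Qed.

(** * Coefficients of the limit key polynomial *)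

Variables (F : {poly K}) (y0 : L).
Hypothesis F_neq0 : F != 0.
Hypothesis F_val : forall c, Gge (eps Q0) (taylor F) c <-> le c y0.
Hypothesis F_unst : forall Q, T Q -> exists c, ge F c /\ ~ Gge (eps Q) (taylor F) c.
Hypothesis F_min : forall f, (size f < size F)%N -> exists2 Q1, T Q1 &
  forall Q, T Q -> le (gam Q1) (gam Q) -> forall c, ge f c -> Gge (eps Q) (taylor f) c.

Lemma eps_off Q : eps Q = eps Q0 + off Q.
Proof. by rewrite /eps /off; zmod. Qed.

(** For s >= 1 the larger weight gains s [off Q]. If the term s = 0 violated the bound, it would
    determine N_Q(F), contradicting instability. *)
Lemma F_lower Q : T Q -> Gge (eps Q) (taylor F) (y0 + off Q).
Proof.
move=> hQ; have hs s : (0 < s)%N -> ge F^`N(s) (y0 + off Q - eps Q *+ s).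
  case: s => // s _; have := (F_val y0).2 (le_refl _) s.+1; rewrite coef_taylor.
  apply: ge_le; rewrite (eps_off Q).
  by apply: (le_cert (c := off Q *+ s)); [apply/nnMn/off_ge0 | zmod].
suff h0 : ge F (y0 + off Q).
  move=> [|s]; rewrite coef_taylor; last exact: hs.
  by rewrite nderivn0 mulr0n subr0.
have [c [hc hnc]] := F_unst hQ; apply: contraT => hneg; case: hnc.
case ha: (nu F) => [a|]; last by case/negP: hneg; apply: ge_None.
rewrite (geE _ ha) in hc; rewrite (geE _ ha) in hneg; have {hneg} hay := nle_le hneg.
move=> [|s]; rewrite coef_taylor.
  by rewrite nderivn0 mulr0n subr0 (geE _ ha).
apply: ge_le (hs s.+1 isT); have h := le_tr hc hay.
by apply: (le_cert (c := y0 + off Q - c)); [apply: sub_le | zmod].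
Qed.

(** Derivatives of order at least [size F] vanish, so changing the weight shifts the bound by at
    most [off Q *+ size F]. *)
Lemma F_upper Q c : T Q -> Gge (eps Q) (taylor F) c -> le c (y0 + off Q *+ size F).
Proof.
move=> hQ h; have /F_val : Gge (eps Q0) (taylor F) (c - off Q *+ size F).
  move=> s; rewrite coef_taylor; case: (leqP (size F) s) => hs.
    by rewrite nderivn_poly0 // ge0.
  have := h s; rewrite coef_taylor; apply: ge_le; rewrite (eps_off Q).
  have [k ->] : exists k, size F = (s + k)%N by exists (size F - s)%N; lia.
  by apply: (le_cert (c := off Q *+ k)); [apply/nnMn/off_ge0 | zmod].
move=> h'; apply: (le_cert (c := y0 - (c - off Q *+ size F))); last by zmod.
exact: sub_le.
Qed.

Lemma F_coef_ge R j : T R -> ge (coefQ R F j) (y0 - gam Q0 *+ j).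
Proof.
move=> hR; apply: (taylor_coefQ _ m_gt0 (T_low T_Q0) (T_lin T_Q0 hR (T_min hR))).
by apply/F_val; apply: le_refl.
Qed.

(** Expands R^j = ((R - Q) + Q)^j in the R-expansion of [F] and isolates one binomial term. *)
Lemma rebase_F Q R l j0 i0 c : T Q -> T R -> (i0 <= j0)%N ->
  (forall j i, (i <= j)%N -> (j, i) != (j0, i0) ->
     ge (coefQ Q (coefQ R F j * (R - Q) ^+ i * Q ^+ (j - i)) l) c) ->
  ge (coefQ Q F l - coefQ Q (coefQ R F j0 * (R - Q) ^+ i0 * Q ^+ (j0 - i0)) l *+ 'C(j0, i0)) c.
Proof.
move=> hQ hR hij h; pose n := maxn (size F) j0.+1.
have hj0 : (j0 < n)%N by rewrite leq_maxr.
rewrite {1}(coefQ_expand m_gt0 (T_monic hR) (T_size hR) (leq_maxl (size F) j0.+1)) -/n.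
have expand j : coefQ Q (coefQ R F j * R ^+ j) l =
    \sum_(i < j.+1) coefQ Q (coefQ R F j * (R - Q) ^+ i * Q ^+ (j - i)) l *+ 'C(j, i).
  rewrite -{2}(subrK Q R) [R - Q + Q]addrC exprDn mulr_sumr coefQ_sum; apply: eq_bigr => i _.
  by rewrite -coefQMn mulrnAr mulrAC mulrA.
rewrite coefQ_sum (bigD1 (Ordinal hj0)) //= expand (bigD1 (Ordinal (hij : i0 < j0.+1)%N)) //=.
set A := _ *+ 'C(j0, i0); rewrite -[A + _ + _]addrA [A + _]addrC addrK; apply: ge_add.
  apply: ge_sum => i hi; apply: ge_Mn; apply: h; first by rewrite -ltnS.
  by rewrite xpair_eqE eqxx /=.
apply: ge_sum => j hj; rewrite expand; apply: ge_sum => i _; apply: ge_Mn.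
apply: h; first by rewrite -ltnS.
by rewrite xpair_eqE negb_and; apply/orP; left.
Qed.

(* [y0] is the value of [F] when [Q0] has its own value, so the coefficient [F_j]
   is at least [y0 - j gam Q0]; it vanishes if it exceeds this bound by every
   element of [H] (the [off Q1] are cofinal in [H]) as the base grows. *)
Definition vanishing j := forall Q1, T Q1 -> exists2 R0, T R0 &
  forall R, T R -> le (gam R0) (gam R) -> ge (coefQ R F j) (y0 + off Q1 - gam Q0 *+ j).

Let D := ((size F).-1 %/ m)%N.

Lemma F_size_lt : (size F <= m * D.+1)%N.
Proof.
have := ltn_ceil (size F).-1 m_gt0; rewrite -/D mulnC.
by rewrite -ltnS prednK // size_poly_gt0.
Qed.

Lemma top_not_vanishing : ~ vanishing D.
Proof.
move=> hv; pose t := coefQ Q0 F D * Q0 ^+ D.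
have Q0m := T_monic T_Q0; have sQ0 := T_size T_Q0.
(* Going from a large [R] back to [Q0], terms with j < D do not reach Q0^D and those with j > D are
   0, so only F_{R,D} contributes. *)
have Q0top Q1 : T Q1 -> ge (coefQ Q0 F D) (y0 + off Q1 - gam Q0 *+ D).
  move=> hQ1; have [R hR hge] := hv Q1 hQ1.
  have {}hge := hge R hR (le_refl _).
  have off0 : off Q0 = 0 by rewrite /off subrr.
  have := @rebase_F Q0 R D D 0 (y0 + off Q1 - gam Q0 *+ D) T_Q0 hR isT.
  rewrite expr0 mulr1 subn0 coefQ_mulX // leqnn subnn bin0 mulr1n.
  rewrite (coefQ_small 0 Q0m sQ0 (coefQ_size F D (T_monic hR) (T_size hR))) /= => h.
  rewrite -[X in ge X](subrK (coefQ R F D)); apply: ge_add => //.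
  apply: h => j i hij hne.
  have := @rebase_term_ge Q0 R (coefQ R F j) D j i (y0 + off Q1) T_Q0 hR (T_min hR).
  rewrite off0 mul0rn addr0; apply=> //; first exact: (coefQ_size _ _ (T_monic hR) (T_size hR)).
  case/andP; rewrite leq_eqVlt => /orP[/eqP<-|hDj] _; first exact: hge.
  rewrite (coefQ_eq0 (T_monic hR) (T_size hR)) ?ge0 //.
  by apply: leq_trans F_size_lt _; rewrite leq_mul2l hDj orbT.
have sFt : (size (F - t)%R < size F)%N.
  have sF0 : (0 < size F)%N by rewrite size_poly_gt0.
  have Q0D : Q0 ^+ D != 0 by rewrite expf_neq0 // monic_neq0.
  (* By the choice of [D] the quotient of [F] by Q0^D is already reduced modulo [Q0]. *)
  have tE : F - t = F %% Q0 ^+ D.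
    rewrite /t /coefQ modp_small; first by rewrite {1}(divp_eq F (Q0 ^+ D)) addrC addKr.
    rewrite size_divp // (size_monic_exp _ Q0m sQ0) sQ0 /= ltnS leq_subLR.
    by rewrite addnC -mulnS F_size_lt.
  rewrite tE; apply: (@leq_trans (size (Q0 ^+ D))); first by rewrite ltn_modp.
  rewrite (size_monic_exp _ Q0m sQ0) mulnC -[X in (_ <= X)%N](prednK sF0) ltnS.
  exact: leq_divM.
have [R hR /(_ R hR (le_refl _)) stab] := F_min sFt.
have ht Q1 : T Q1 -> Gge (eps R) (taylor t) (y0 + off Q1).
  move=> hQ1; rewrite taylorM taylorX.
  have -> : y0 + off Q1 = (y0 + off Q1 - gam Q0 *+ D) + gam Q0 *+ D by zmod.
  apply: Gge_mul.
    by apply: (low_taylor (T_low hR)); [apply: coefQ_size | apply: Q0top].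
  apply: Gge_exp; apply: (@Gge_eps (eps Q0)); first by apply: leD2; [apply: T_min | apply: le_refl].
  exact: (linear_taylor (T_lin T_Q0 T_Q0 (le_refl _))).
(* [P] is taken beyond the bound that [F_upper] gives at [R]. *)
have [P1 [hP1 hP1n]] := off_muln (size F) hR.
have [P hP hPn] := T_nomax hP1.
have hPbig : ~~ le (off P) (off R *+ size F).
  apply: contra hPn => h; have h' := le_tr h hP1n.
  by apply: (le_cert (c := off P1 - off P)); [apply: sub_le | rewrite /off; zmod].
(* Up to y0 + [off P] the term [t] is negligible, and [F] behaves like the stable F - t. *)
have noF mu : ge F mu -> le mu (y0 + off P) -> Gge (eps R) (taylor F) mu.
  move=> h1 h2; rewrite -(subrK t F) taylorD; apply: Gge_add; last exact: Gge_le (ht P hP).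
  apply: stab; apply: ge_sub => //; apply: ge_le h2 _.
  by have := ht P hP 0%N; rewrite coef_taylor nderivn0 mulr0n subr0.
have [c [hc hnc]] := F_unst hR; apply: hnc; apply: (noF) => //.
apply: contraT => /nle_le hcP.
have /(F_upper hR) h := noF _ (ge_le hcP hc) (le_refl _).
case/negP: hPbig; apply: (le_cert (c := y0 + off R *+ size F - (y0 + off P))); last by zmod.
exact: sub_le.
Qed.

Lemma vanishing_range l k : (forall i, (i < k)%N -> vanishing (l + i)) ->
  forall Q1, T Q1 -> exists2 R0, T R0 & forall R, T R -> le (gam R0) (gam R) ->
    forall i, (i < k)%N -> ge (coefQ R F (l + i)) (y0 + off Q1 - gam Q0 *+ (l + i)).
Proof.
move=> + Q1 hQ1; elim: k => [|k IH] h; first by exists Q0.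
have [i hi|R1 hR1 h1] := IH; first by apply: h; apply: ltnW.
have [R2 hR2 h2] := h k (ltnSn k) Q1 hQ1.
have [R0 [hR0 h01 h02]] := T_max hR1 hR2; exists R0 => // R hR hle i.
rewrite ltnS leq_eqVlt => /orP[/eqP->|hi]; first by apply: h2 => //; apply: le_tr hle.
by apply: h1 => //; apply: le_tr hle.
Qed.

(** The last hypothesis expresses that nu(F_{Q,l} Q^l) bounds every nu_R(F), as membership of [l] in
    J provides. *)
Lemma J_empty l QJ : (l <= D)%N -> T QJ ->
  (forall Q R c, T Q -> T R -> le (gam QJ) (gam Q) -> Gge (eps R) (taylor F) c ->
     ge (coefQ Q F l) (c - gam Q *+ l)) -> False.
Proof.
move=> hlD hQJ hJ.
have [i0 hi0 hlt] : exists2 i0, ~ vanishing (l + i0) &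
    forall i, (i < i0)%N -> vanishing (l + i).
  have [|k hk hmin] := @least_nat (fun i => ~ vanishing (l + i)) (D - l).
    by rewrite subnKC //; apply: top_not_vanishing.
  by exists k => // i hi; apply: NNPP; apply: hmin.
have [Q2 [hQ2 hfreq]] : exists Q2, T Q2 /\ forall R0, T R0 -> exists R,
    [/\ T R, le (gam R0) (gam R) & ~ ge (coefQ R F (l + i0)) (y0 + off Q2 - gam Q0 *+ (l + i0))].
  apply: NNPP => hno; apply: hi0 => Q1 hQ1; apply: NNPP => hn; apply: hno.
  exists Q1; split=> // R0 hR0; apply: NNPP => hn'; apply: hn; exists R0 => // R hR hle.
  by apply: contraT => /negP hge; case: hn'; exists R.
have [|w [hw [Rw hRw hwle]]] := @T_char 'C(l + i0, i0); first by rewrite bin_gt0 leq_addl.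
(* One more [off Q] must outweigh both the defect [off Q2] and the value [w] of the binomial
   coefficient. *)
have [Q [hQ hQJQ hQ0 hQw]] : exists Q, [/\ T Q, le (gam QJ) (gam Q), ~~ le (gam Q) (gam Q0)
    & le (off Q2 + w) (off Q)].
  have [P1 [hP1 h1]] := off_add hQ2 hRw.
  have [P2 hP2 h2] := T_nomax T_Q0.
  have [P3 [hP3 h31 h32]] := T_max hP1 hP2.
  have [P4 [hP4 h41 h42]] := T_max hP3 hQJ.
  exists P4; split=> //; first by apply: nle_trr h2 _; apply: le_tr h41.
  apply: (@le_tr (off Q2 + off Rw)); first by apply: leD2 => //; apply: le_refl.
  by apply: le_tr h1 _; apply: off_le; apply: le_tr h41.
have [Q1 [hQ1 hQ1le]] := off_muln i0.+1 hQ.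
have [R1 hR1 hvan] := vanishing_range hlt hQ1.
have [R2 hR2 hR2Q] := T_nomax hQ.
have [R3 [hR3 h31 h32]] := T_max hR1 hR2.
have [R [hR hR3R hRneg]] := hfreq R3 hR3.
have hRQ : ~~ le (gam R) (gam Q) by apply: nle_trr hR2Q _; apply: le_tr hR3R.
have hQR := nle_le hRQ.
have {}hvan := hvan R hR (le_tr h31 hR3R).
(* The isolated term carries [i0] factors R - Q; the bound [c] corresponds to one factor more. *)
pose c := y0 - gam Q0 *+ l + off Q *+ i0.+1.
have sR j : (size (coefQ R F j) <= m)%N by apply: (coefQ_size _ _ (T_monic hR) (T_size hR)).
have hFl : ge (coefQ Q F l) c.
  (* The summand [l] pays for the difference between [gam Q *+ l] and [gam Q0 *+ l]. *)
  have [P [hP hPle]] := off_muln (l + i0.+1) hQ.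
  apply: ge_le (hJ Q P (y0 + off P) hQ hP hQJQ (F_lower hP)); rewrite /c.
  apply: (le_cert (c := off P - off Q *+ (l + i0.+1))); first exact: sub_le.
  by rewrite /off; zmod.
have hsub : ge (coefQ Q F l -
    coefQ Q (coefQ R F (l + i0) * (R - Q) ^+ i0 * Q ^+ (l + i0 - i0)) l *+ 'C(l + i0, i0)) c.
  apply: rebase_F => // [|j i hij hne]; first exact: leq_addl.
  (* For i <= i0 only indices j in [l, l + i0) remain, where F_{R,j} is large by minimality of [i0];
     for i > i0 the factors R - Q alone suffice. *)
  case: (leqP i i0) => hi.
    have := @rebase_term_ge Q R (coefQ R F j) l j i (y0 + off Q1) hQ hR hQR (sR j) hij.
    move=> h; apply: ge_le (h _) => [|/andP[hlj hjl]].
      apply: (le_cert (c := off Q1 - off Q *+ i0.+1 + off Q *+ i)).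
        by apply: nnD; [apply: sub_le | apply/nnMn/off_ge0].
      by rewrite /c; zmod.
    rewrite -(subnKC hlj); apply: hvan; rewrite ltn_subLR //.
    have hji := leq_trans hjl (leq_add (leqnn l) hi).
    rewrite ltn_neqAle hji andbT; apply: contraNneq hne => hj.
    by move: hjl; rewrite hj leq_add2l xpair_eqE eqxx eqn_leq hi => ->.
  have := @rebase_term_ge Q R (coefQ R F j) l j i y0 hQ hR hQR (sR j) hij.
  move=> h; apply: ge_le (h _) => [|_]; last exact: F_coef_ge.
  have [k ->] : exists k, i = (i0.+1 + k)%N by exists (i - i0.+1)%N; rewrite subnKC.
  by apply: (le_cert (c := off Q *+ k)); [apply/nnMn/off_ge0 | rewrite /c; zmod].
have hlead : ge (coefQ Q (coefQ R F (l + i0) * (R - Q) ^+ i0) 0 *+ 'C(l + i0, i0)) c.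
  have := ge_sub hFl hsub; rewrite opprB addrC subrK addnK coefQ_mulX ?T_monic //.
  by rewrite leqnn subnn.
have {}hlead : ge (coefQ Q (coefQ R F (l + i0) * (R - Q) ^+ i0) 0) (c - w).
  apply: (@ge_mulK ('C(l + i0, i0)%:R)%:P _ w); first by rewrite nuC.
  have -> : w + (c - w) = c by zmod.
  by rewrite mul_polyC scaler_nat.
apply: hRneg; have := rebase_leading hQ hR hQ0 hRQ (sR _) hlead; apply: ge_le.
apply: (le_cert (c := off Q - (off Q2 + w))); first exact: sub_le.
by rewrite /c /off; zmod.
Qed.

End Tail.

(** * Values of the integers *)

Lemma natr_polyC n : (n%:R : {poly K}) = (n%:R)%:P.
Proof. by rewrite rmorph_nat. Qed.

Lemma ge_natr n : ge n%:R 0.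
Proof. by apply: ge_Mn; apply: nu_ge nu1. Qed.

(** By Bezout, 1 is a combination of q and p; both having positive value would give 1 positive
    value. *)
Lemma v_prime p q : res_char_exp le v p -> prime q -> q <> p -> v q%:R = Some 0.
Proof.
case=> [[pp vp]|[_ h]] pq hqp; last exact: h.
rewrite -nuC -natr_polyC; apply: ge_ngt; first exact: ge_natr.
apply: contraL (nu_ngt nu1) => vq; rewrite negbK.
have /eqP hg : coprime q p by rewrite prime_coprime // dvdn_prime2 //; apply/eqP.
case: (egcdnP p (prime_gt0 pq)) => x y hxy _; rewrite hg in hxy.
have -> : (1 : {poly K}) = x%:R * q%:R - y%:R * p%:R.
  by rewrite -!natrM hxy natrD addrC addKr.
apply: gt_sub; rewrite -[0]addr0; apply: gt_mul => //; try exact: ge_natr.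
by rewrite /gt natr_polyC nuC.
Qed.

(** Prime factors are split off one at a time, and only [p] can contribute. *)
Lemma v_natr p h n : res_char_exp le v p -> v p%:R = Some h -> (0 < n)%N ->
  exists k, v n%:R = Some (h *+ k).
Proof.
move=> hp hvp; have [k] := ubnP n; elim: k n => // k IH n hnk n0.
case: (ltnP 1 n) => n1; last first.
  by exists 0%N; have -> : n = 1%N by [lia]; rewrite v1 mulr0n.
have pq := pdiv_prime n1; have dq := pdiv_dvd n; set q := pdiv n in pq dq.
have [||j hj] := IH (n %/ q)%N.
- by apply: leq_trans (ltn_Pdiv (prime_gt1 pq) n0) _.
- by rewrite divn_gt0 ?prime_gt0 // dvdn_leq.
rewrite -(divnK dq) natrM vM hj.
have [->|/eqP hqp] := eqVneq q p; first by exists j.+1; rewrite hvp /= mulrSr.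
by exists j; rewrite (v_prime hp pq hqp) /= addr0.
Qed.

(** * Vertical unboundedness *)

Lemma scale_ge0 (a : L) (r : rat) : le 0 a -> (0 <= r)%R -> le 0 (r *: a).
Proof.
move=> ha hr; have [n [k [hk ->]]] : exists n k, (0 < k)%N /\ r = n%:R / k%:R.
  exists `|numq r|%N, `|denq r|%N; split; first by rewrite absz_gt0 denq_neq0.
  by rewrite -[LHS]divq_num_den !pmulrn !gez0_abs ?numq_ge0 ?denq_ge0.
case: k hk => // k _; apply: (@leMn_cancel _ _ k); rewrite mul0rn.
by rewrite mulrC -scalerA scale_divn // scaler_nat; apply: nnMn.
Qed.

(** Bernoulli's inequality and the Archimedean property. *)
Lemma expr_ge2 (q : rat) : (1 < q)%R -> exists n, (2 <= q ^+ n)%R.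
Proof.
move=> q1; have q0 : (0 <= (q - 1)^-1)%R by rewrite Num.Theory.invr_ge0; lra.
have [n hn] : exists n, (1 <= n%:R * (q - 1))%R.
  exists (Num.bound (q - 1)^-1); rewrite -Num.Theory.ler_pdivrMr; last by lra.
  by rewrite mul1r; apply/Order.POrderTheory.ltW/Num.Theory.archi_boundP.
have bern k : (1 + k%:R * (q - 1) <= q ^+ k)%R.
  elim: k => [|k IH]; first by rewrite expr0; lra.
  rewrite exprS -natr1; have k0 : (0 <= k%:R :> rat)%R by apply: Num.Theory.ler0n.
  have h1 : (0 <= q * (q ^+ k - (1 + k%:R * (q - 1))))%R.
    by apply: Num.Theory.mulr_ge0; [lra | rewrite Num.Theory.subr_ge0].
  have h2 : (0 <= k%:R * ((q - 1) * (q - 1)))%R.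
    by apply: Num.Theory.mulr_ge0 => //; apply: Num.Theory.mulr_ge0; lra.
  by lra.
exists n; apply: Order.POrderTheory.le_trans (bern n).
by rewrite -[2]/(1 + 1); apply: Num.Theory.lerD.
Qed.

(* Iterating the failure of vertical boundedness multiplies the distance to [x]
   by arbitrarily large rationals. *)
Lemma unbounded_double (low : L -> Prop) : ~ vertically_bounded le low ->
  exists2 x, low x & forall y, low y -> le x y -> exists2 z, low z & le ((y - x) *+ 2) (z - x).
Proof.
move=> hnb; apply: NNPP => hno; apply: hnb => x hx q q1.
apply: NNPP => hnq; apply: hno; exists x => // y hy hxy.
have step y' : low y' -> exists2 z, low z & le (q *: (y' - x)) (z - x).
  move=> hy'; apply: NNPP => hnz; apply: hnq; exists y'; split=> // z hz.
  rewrite /ltL; have hn : ~~ le (q *: (y' - x)) (z - x).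
    by apply/negP => h; apply: hnz; exists z.
  by rewrite hn nle_le.
have iter n : exists2 z, low z & le (q ^+ n *: (y - x)) (z - x).
  elim: n => [|n [z hz hle]]; first by exists y => //; rewrite expr0 scale1r le_refl.
  have [z' hz' hle'] := step z hz; exists z' => //; apply: le_tr hle'.
  apply: (le_cert (c := q *: (z - x - q ^+ n *: (y - x)))).
    by apply: scale_ge0; [apply: sub_le | lra].
  by rewrite exprS -scalerA -scalerDr [_ + (z - x - _)]addrC subrK.
have [n hn] := expr_ge2 q1; have [z hz hle] := iter n; exists z => //.
apply: le_tr hle; apply: (le_cert (c := (q ^+ n - 2) *: (y - x))).
  by apply: scale_ge0; [apply: sub_le | lra].
by rewrite -scaler_nat -scalerDl [2%:R + _]addrC subrK.
Qed.

(** A positive [t] rules out a largest finite value, so finite lower bounds also detect [None]. *)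
Lemma option_eq_ole (t : L) (x y : option L) : ~~ le t 0 ->
  (forall c, ole le (Some c) x <-> ole le (Some c) y) -> x = y.
Proof.
move=> ht; have big b : ~ forall c, le c b.
  move=> /(_ (b + t)) h; case/negP: ht.
  by apply: (le_cert (c := b - (b + t))); [apply: sub_le | zmod].
case: x y => [a|] [b|] //= h; last 2 first.
- by case: (big a) => c; apply/h.
- by case: (big b) => c; apply/h.
by congr Some; apply: le_eq; apply/h; apply: le_refl.
Qed.

(** * Construction of the tail and conclusion *)

Section Cofinal.
Variables (p m : nat) (Qs : {poly K} -> Prop) (F : {poly K}).
Hypothesis charp : res_char_exp le v p.
Hypothesis m_gt0 : (0 < m)%N.
Hypothesis Psi_nomax :
  forall P, Psi le nu m P -> exists P', Psi le nu m P' /\ olt le (nu P) (nu P').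
Hypothesis Qs_Psi : forall Q, Qs Q -> Psi le nu m Q.
Hypothesis Qs_cofinal : forall P, Psi le nu m P -> exists Q, Qs Q /\ ole le (nu P) (nu Q).
Hypothesis F_limit : limit_key_poly le nu Qs F.
Hypothesis s_infty1 : eventually le nu Qs (fun Q => forall s, Iset le nu Q s <-> s = 1%N).
Hypothesis Qs_unbounded : ~ vertically_bounded le (gammaL le v nu Qs).
Hypothesis vp_inv :
  exists h, v p%:R = Some h /\ invariance_group (gammaL le v nu Qs) (in_Gamma v) h.

Lemma Qs_nu Q : Qs Q -> nu Q = Some (gam Q).
Proof. by move/Qs_Psi => [[_ h _] _]; rewrite /gam; case: (nu Q) h. Qed.

Lemma Qs_ole Q R : Qs Q -> Qs R -> ole le (nu Q) (nu R) = le (gam Q) (gam R).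
Proof. by move=> /Qs_nu -> /Qs_nu ->. Qed.

Lemma Qs_max Q R : Qs Q -> Qs R ->
  exists P, [/\ Qs P, le (gam Q) (gam P) & le (gam R) (gam P)].
Proof. exact: T_max. Qed.

Lemma Qs_nomax Q : Qs Q -> exists2 R, Qs R & ~~ le (gam R) (gam Q).
Proof.
move=> hQ; have [P [hP hlt]] := Psi_nomax (Qs_Psi hQ).
have [R [hR hle]] := Qs_cofinal hP; exists R => //.
move: hlt hle; rewrite (Qs_nu hQ) (Qs_nu hR) /olt; case: (nu P) => //= b.
by case/andP => _; apply: nle_trr.
Qed.

Lemma Jset_empty l : ~ Jset le v nu Qs F m l.
Proof.
move=> [hlD [QJ hQJ hJ]].
have [Q1 hQ1 hI] := s_infty1.
have lin1 Q : Qs Q -> le (gam Q1) (gam Q) -> exists e, low_level m e /\ linear_at m e (gam Q) Q.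
  move=> hQ hle; have [|e [g [_ hg hlow hlin]]] := key_poly_linear m_gt0 (Qs_Psi hQ).
    by apply: hI => //; rewrite Qs_ole.
  by exists e; split=> //; move: hlin; have -> : g = gam Q by rewrite /gam hg.
have [e1 [hlow1 hlin1]] := lin1 Q1 hQ1 (le_refl _); pose d := gam Q1 - e1.
pose T1 Q := Qs Q /\ le (gam Q1) (gam Q).
have T1_lin Q : T1 Q -> low_level m (eps d Q) /\ linear_at m (eps d Q) (gam Q) Q.
  move=> [hQ hle]; have [e [hlow hlin]] := lin1 Q hQ hle.
  have [_ he] := linear_transfer hlow1 hlin1 hlin (Qs_nu hQ) hle.
  by have -> : eps d Q = e by rewrite he /eps /d; zmod.
have T1_lin2 Q R : T1 Q -> T1 R -> le (gam Q) (gam R) ->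
    linear_at m (eps d Q) (gam Q) R.
  move=> hQ hR hle; have [hlQ hQlin] := T1_lin Q hQ; have [_ hRlin] := T1_lin R hR.
  by have [] := linear_transfer hlQ hQlin hRlin (Qs_nu hR.1) hle.
have T1_nomax Q : T1 Q -> exists2 R, T1 R & ~~ le (gam R) (gam Q).
  move=> [hQ hle]; have [R hR hRQ] := Qs_nomax hQ; exists R => //; split=> //.
  exact: le_tr hle (nle_le hRQ).
have gamG Q : T1 Q -> in_Gamma v (gam Q).
  apply: (@gam_in_Gamma m T1 Q1 d m_gt0) => //.
  - by move=> R [/Qs_nu].
  - by move=> R /T1_lin[].
  - by split; rewrite ?le_refl.
  - by move=> R [].
have [x [hxG [Qx [gx [hQx hgx hxle]]]] hdouble] := unbounded_double Qs_unbounded.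
(* The base point lies beyond [Q1], after which I(Q) = {1}, and beyond [x], from which distances
   double. *)
have [Q0 [hQ0 h10 hx0]] := Qs_max hQ1 hQx.
have {}hx0 : le x (gam Q0).
  by apply: le_tr hx0; move: hxle; have -> : gx = gam Qx by rewrite /gam hgx.
pose T Q := Qs Q /\ le (gam Q0) (gam Q).
have TT1 Q : T Q -> T1 Q by move=> [hQ h]; split=> //; apply: le_tr h.
have T_Q0 : T Q0 by split; rewrite ?le_refl.
have T_min Q : T Q -> le (gam Q0) (gam Q) by case.
have T_nu Q : T Q -> nu Q = Some (gam Q) by case=> /Qs_nu.
have T_low Q : T Q -> low_level m (eps d Q) by move/TT1/T1_lin=> [].
have T_lin Q R : T Q -> T R -> le (gam Q) (gam R) -> linear_at m (eps d Q) (gam Q) R.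
  by move=> /TT1 hQ /TT1 hR; apply: T1_lin2.
have T_nomax Q : T Q -> exists2 R, T R & ~~ le (gam R) (gam Q).
  move=> [hQ hle]; have [R hR hRQ] := Qs_nomax hQ; exists R => //; split=> //.
  exact: le_tr hle (nle_le hRQ).
have above z : gammaL le v nu Qs z -> exists2 R, T R & le z (gam R).
  move=> [_ [R [g [hR hg hz]]]]; have [P [hP hRP h0P]] := Qs_max hR hQ0.
  exists P; first by split.
  by apply: le_tr hRP; move: hz; have -> : g = gam R by rewrite /gam hg.
have T_gammaL Q : T Q -> gammaL le v nu Qs (gam Q).
  move=> hQ; split; first by apply/gamG/TT1.
  by exists Q, (gam Q); split; [case: hQ | apply: T_nu | apply: le_refl].
have T_double Q : T Q -> exists2 R, T R & le (off Q0 Q *+ 2) (off Q0 R).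
  move=> hQ; have [|z hz hle] := hdouble _ (T_gammaL Q hQ).
    by apply: le_tr hx0 _; apply: T_min.
  have [R hR hzR] := above z hz; exists R => //.
  (* Raising the origin from [x] to [gam Q0] preserves doubling, with surplus [gam Q0 - x]. *)
  apply: (le_cert (c := (gam R - z) + (z - x - (gam Q - x) *+ 2) + (gam Q0 - x))).
    by apply: nnD; [apply: nnD; apply: sub_le | apply: sub_le].
  by rewrite /off; zmod.
have T_char n : (0 < n)%N -> exists w, v n%:R = Some w /\ exists2 R, T R & le w (off Q0 R).
  move=> n0; have [h [hh [_ hinv]]] := vp_inv; have [k hk] := v_natr charp hh n0.
  exists (h *+ k); split=> //.
  (* Translation by [h] preserves the cut, so some offset dominates [h]; doubling takes care of its
     multiples. *)
  have [|R hR hhR] := above (h + gam Q0).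
    by apply/hinv; exists (gam Q0); split=> //; apply: T_gammaL.
  have {}hhR : le h (off Q0 R).
    apply: (le_cert (c := gam R - (h + gam Q0))); [exact: sub_le | rewrite /off; zmod].
  have [P [hP hle]] := @off_muln T Q0 T_min T_double R k hR.
  by exists P => //; apply: le_tr hle; apply: leMn.
have [t ht] : exists t, ~~ le t 0.
  have [R hR hn] := T_nomax Q0 T_Q0; exists (gam R - gam Q0); apply: contra hn => h.
  by apply: (le_cert (c := 0 - (gam R - gam Q0))); [apply: sub_le | zmod].
have nuQP Q f c : T Q -> ole le (Some c) (nuQ le nu Q f) <-> Gge (eps d Q) (taylor f) c.
  by move=> hQ; apply: (@T_nuQ m T Q0 d).
have eps_le Q R : le (gam Q) (gam R) -> le (eps d Q) (eps d R).
  by move=> h; apply: leD2 => //; apply: le_refl.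
have [Fm F_unstable F_least] := F_limit.
(* If [Q] met every lower bound of [F], so would later members, whose weights are larger, and [F]
   would be stable. *)
have F_unst Q : T Q -> exists c, ge F c /\ ~ Gge (eps d Q) (taylor F) c.
  move=> hQ; apply: NNPP => hno; apply: F_unstable; exists Q; first by case: hQ.
  move=> R hR; rewrite Qs_ole //; last by case: hQ.
  move=> hle; have hTR : T R by split=> //; apply: le_tr hle; apply: T_min.
  apply: (option_eq_ole ht) => c; rewrite nuQP //; split=> [/(_ 0%N)|hc].
    by rewrite coef_taylor nderivn0 mulr0n subr0.
  apply: (Gge_eps (eps_le _ _ hle)); apply: NNPP => hn; apply: hno; exists c; split=> //.
have F_fin Q : T Q -> exists y, nuQ le nu Q F = Some y.
  move=> hQ; case hy: (nuQ le nu Q F) => [y|]; first by exists y.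
  by have [c [_ []]] := F_unst Q hQ; apply/nuQP; rewrite ?hy.
have [y0 hy0] := F_fin Q0 T_Q0.
have [QK [hQK hJK h0K]] := Qs_max hQJ hQ0.
apply: (@J_empty m T Q0 d m_gt0 T_nu T_low T_lin T_Q0 T_min T_nomax T_double T_char F y0
  (monic_neq0 Fm) _ F_unst _ l QK hlD _ _).
- by move=> c; rewrite -nuQP // hy0.
- move=> f sf; have [->|f0] := eqVneq f 0.
    by exists Q0 => // Q _ _ c _ s; rewrite coef_taylor linear0 ge0.
  have lf0 : lead_coef f != 0 by rewrite lead_coef_eq0.
  (* Minimality of [F] concerns monic polynomials only, so [f] is normalised and the value [w] of
     its leading coefficient restored later. *)
  pose g := (lead_coef f)^-1 *: f.
  have gm : g \is monic by rewrite monicE lead_coefZ mulVf.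
  have sg : size g = size f by rewrite size_scale // invr_eq0.
  have [R hR hst] : Qstable le nu Qs g.
    by apply: NNPP => /(F_least _ gm); rewrite leqNgt sg sf.
  have [P [hP hRP h0P]] := Qs_max hR hQ0; exists P; first by split.
  move=> Q hQ hPQ c hc; have [w hw] := v_fin lf0.
  have fE : f = (lead_coef f)%:P * g by rewrite mul_polyC scalerA mulfV // scale1r.
  have hg : ge g (c - w).
    apply: (@ge_mulK (lead_coef f)%:P _ w); first by rewrite nuC.
    by rewrite -fE; have -> : w + (c - w) = c by zmod.
  have hG : Gge (eps d Q) (taylor g) (c - w).
    apply/nuQP => //; rewrite hst //; first by case: hQ.
    by rewrite Qs_ole //; [apply: le_tr hPQ | case: hQ].
  move=> s; rewrite coef_taylor fE mul_polyC nderivnZ -mul_polyC.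
  have -> : c - eps d Q *+ s = w + (c - w - eps d Q *+ s) by zmod.
  apply: ge_mul; first by apply: nu_ge; rewrite nuC.
  by have := hG s; rewrite coef_taylor.
- by split.
- move=> Q R c hQ hR hKQ hc.
  have := hJ Q; rewrite Qs_ole //; last by case: hQ.
  move=> /(_ _ (le_tr hJK hKQ)); rewrite (T_nu Q hQ) /betaQ => /(_ hQ.1).
  case hb: (nu (coefQ Q F l)) => [b|] /=; last by move=> _; apply: ge_None.
  move=> [hG hnd]; rewrite (geE _ hb).
  have [y hy] := F_fin R hR.
  have hcy : le c y by move/(nuQP R F c hR): hc; rewrite hy.
  (* An element of Gamma below some nu_R(F) would lie in [deltaL]. *)
  suff h : le c (b + gam Q *+ l).
    by apply: (le_cert (c := b + gam Q *+ l - c)); [apply: sub_le | zmod].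
  apply: contraT => /nle_le h; case: hnd; split=> //.
  by exists R, y; split=> //; [case: hR | apply: le_tr hcy].
Qed.

End Cofinal.
End Values.

Theorem mainTheorem15
  (K : fieldType) (L : lmodType rat) (le : rel L)
  (v : K -> option L) (nu : {poly K} -> option L)
  (p m : nat) (Qs : {poly K} -> Prop) (F : {poly K}) :
  ordered_group le ->
  is_valuation le v ->
  extends_valuation le v nu ->
  well_specified le v nu ->
  res_char_exp le v p ->
  (0 < m)%N ->
  (exists P, Psi le nu m P) ->
  (forall P, Psi le nu m P -> exists P', Psi le nu m P' /\ olt le (nu P) (nu P')) ->
  (* Qs is a subset of Psi_m, well-ordered by nu-values, cofinal in Psi_m *)
  (forall Q, Qs Q -> Psi le nu m Q) ->
  (forall Q R, Qs Q -> Qs R -> nu Q = nu R -> Q = R) ->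
  (forall S : {poly K} -> Prop, (forall Q, S Q -> Qs Q) -> (exists Q, S Q) ->
     exists Q0, S Q0 /\ forall Q, S Q -> ole le (nu Q0) (nu Q)) ->
  (forall P, Psi le nu m P -> exists Q, Qs Q /\ ole le (nu P) (nu Q)) ->
  (* unstable polynomials exist and F is a limit key polynomial *)
  (exists f, ~ Qstable le nu Qs f) ->
  limit_key_poly le nu Qs F ->
  (* s_infty = 1 : I(Q) = {1} for all Q large enough *)
  eventually le nu Qs (fun Q => forall s, Iset le nu Q s <-> s = 1%N) ->
  (* Qs vertically unbounded *)
  ~ vertically_bounded le (gammaL le v nu Qs) ->
  (* v(p) in H *)
  (exists h, v p%:R = Some h /\ invariance_group (gammaL le v nu Qs) (in_Gamma v) h) ->
  (* conclusion: J is empty *)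
  forall l, ~ Jset le v nu Qs F m l.
Proof.
move=> leOG valV extV _ charp m_gt0 _ Psi_nomax Qs_Psi _ _ Qs_cofinal _ F_limit sinf unb vp l.
exact: (Jset_empty leOG valV extV charp m_gt0 Psi_nomax Qs_Psi Qs_cofinal F_limit sinf unb vp).
Qed.
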